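(* Let $p > 2$ be a prime, let $n \ge 3$ and $\lambda := (n-2,1^2)$. Then $\lambda \in \mathcal{C}^2_p$ if and only if $p \mid n$. In this case, the $p$-rank of $H^2(\Sigma_n,S^\lambda_{\mathbb{Z}})$ is $1$, and there is no predecessor of $\lambda$ in $\mathcal{C}^2_p$. If $n = p$, then $\lambda$ is the only partition of $n$ in $\mathcal{C}^2_p$.
   Context: $\Sigma_n$ is the symmetric group on $n$ letters. $S^\lambda_{\mathbb{Z}}$ is the integral Specht module in James' convention (the $\mathbb{Z}\Sigma_n$-submodule of the permutation module on $\lambda$-tabloids spanned by polytabloids, so $S^{(n)}_{\mathbb{Z}}$ is trivial). $\mathcal{C}^2_p := \bigcup_{n \in \mathbb{Z}_{\ge 0}} \{\lambda \vdash n \mid p \text{ divides } |H^2(\Sigma_n,S^\lambda_{\mathbb{Z}})|\}$, where $H^2(\Sigma_n,S^\lambda_{\mathbb{Z}})$ is a finite abelian group. The $p$-rank of a finite abelian group is the number of direct summands $\mathbb{Z}/p\mathbb{Z}$ of its maximal elementary abelian $p$-subgroup. For $\lambda,\mu\in\mathcal{C}^2_p$ such that $\mu$ is obtained from $\lambda$ by adding one node, $\lambda$ is called a predecessor of $\mu$ in $\mathcal{C}^2_p$. *)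

(* Defs.v *)
From HB Require Import structures.
From mathcomp Require Import all_boot all_order all_fingroup all_algebra.
From mathcomp Require Import all_solvable.
From mathcomp Require Import boolp.

Set Implicit Arguments.
Unset Strict Implicit.
Unset Printing Implicit Defensive.

Import GRing.Theory.
Local Open Scope ring_scope.

Record gmodule (G : finGroupType) (M : zmodType) := GModule {
  gact :> G -> M -> M;
  gact1 : forall x, gact 1%g x = x;
  gactM : forall g h x, gact (g * h)%g x = gact g (gact h x);
  gactB : forall g x y, gact g (x - y) = gact g x - gact g y }.

Section Cohomology.

Variables (G : finGroupType) (M : zmodType) (a : gmodule G M).

(* Differentials of the inhomogeneous (bar) cochain complex. *)
Definition coboundary1 (f : {ffun G -> M}) : {ffun G * G -> M} :=
  [ffun x => a x.1 (f x.2) - f (x.1 * x.2)%g + f x.1].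

Definition coboundary2 (f : {ffun G * G -> M}) : {ffun G * G * G -> M} :=
  [ffun x => let: (g, h, k) := x in
     a g (f (h, k)) - f ((g * h)%g, k) + f (g, (h * k)%g) - f (g, h)].

Lemma coboundary1B f f' :
  coboundary1 (f - f') = coboundary1 f - coboundary1 f'.
Proof.
apply/ffunP => x; rewrite !ffunE gactB !opprD.
by rewrite [RHS]addrACA; congr (_ + _); rewrite [RHS]addrACA.
Qed.

Lemma coboundary2B f f' :
  coboundary2 (f - f') = coboundary2 f - coboundary2 f'.
Proof.
apply/ffunP => -[[g h] k]; rewrite !ffunE gactB !opprD.
rewrite [RHS]addrACA; congr (_ + _); rewrite [RHS]addrACA; congr (_ + _).
by rewrite [RHS]addrACA.
Qed.

Definition is_cocycle2 : {pred {ffun G * G -> M}} :=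
  [pred f | coboundary2 f == 0].

Lemma is_cocycle2_closed : zmod_closed is_cocycle2.
Proof.
split=> [|f f']; rewrite !inE; last first.
  by move=> /eqP f0 /eqP f'0; rewrite coboundary2B f0 f'0 subrr.
by rewrite -[X in coboundary2 X](subrr 0) coboundary2B subrr.
Qed.

HB.instance Definition _ :=
  GRing.isZmodClosed.Build {ffun G * G -> M} is_cocycle2 is_cocycle2_closed.

Record cocycle2 :=
  Cocycle2 { cocycle2_val :> {ffun G * G -> M}; _ : cocycle2_val \in is_cocycle2 }.

HB.instance Definition _ := [isSub for cocycle2_val].
HB.instance Definition _ := [Choice of cocycle2 by <:].
HB.instance Definition _ := [SubChoice_isSubZmodule of cocycle2 by <:].

Definition is_coboundary2 : {pred cocycle2} :=
  [pred f | `[< exists h : {ffun G -> M}, val f = coboundary1 h >]].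

Lemma is_coboundary2_closed : zmod_closed is_coboundary2.
Proof.
split=> [|f f']; rewrite !inE.
  by apply/asboolP; exists (0 - 0); rewrite coboundary1B subrr raddf0.
move=> /asboolP[h fh] /asboolP[h' fh']; apply/asboolP; exists (h - h').
by rewrite raddfB /= coboundary1B; congr (_ - _).
Qed.

HB.instance Definition _ :=
  GRing.isZmodClosed.Build cocycle2 is_coboundary2 is_coboundary2_closed.

Definition H2 : zmodType := Quotient.quot is_coboundary2.

End Cohomology.

Definition zmod_iso (A B : zmodType) : Prop :=
  exists f : {additive A -> B}, bijective f.

(* H is finite, and p divides its order. *)
Definition dvd_order (p : nat) (H : zmodType) : Prop :=
  exists A : finZmodType, zmod_iso H A /\ (p %| #|A|)%N.

(* H is finite, and its p-rank is r. *)
Definition has_p_rank (p : nat) (H : zmodType) (r : nat) : Prop :=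
  exists A : finZmodType, zmod_iso H A /\ 'r_p([set: A])%g = r.

Definition is_partition (la : seq nat) : bool :=
  sorted geq la && all (leq 1) la.

Section Specht.

Variable la : seq nat.
Local Notation n := (sumn la).

Definition cell : finType := {i : 'I_(size la) & 'I_(nth 0%N la i)}.
Definition cell_row (c : cell) : nat := tag c.
Definition cell_col (c : cell) : nat := tagged c.

(* Injective fillings of the diagram are bijective, as #|cell| = n. *)
Definition tableau : finType := {t : {ffun cell -> 'I_n} | injectiveb t}.

Definition fill (t : tableau) (c : cell) : 'I_n := val t c.

Fact move_tableau_subproof (s : 'S_n) (t : tableau) :
  injectiveb [ffun c => s (fill t c)].
Proof.
apply/injectiveP => c c'; rewrite !ffunE => /perm_inj.
exact: (injectiveP _ (valP t)).
Qed.

Definition move_tableau (s : 'S_n) (t : tableau) : tableau :=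
  Sub [ffun c => s (fill t c)] (move_tableau_subproof s t).

Definition tableau_row (t : tableau) (i : nat) : {set 'I_n} :=
  [set fill t c | c : cell & cell_row c == i].

Definition tableau_col (t : tableau) (j : nat) : {set 'I_n} :=
  [set fill t c | c : cell & cell_col c == j].

(* Two tableaux are row equivalent iff they have the same row sets, so the
   row equivalence class {t} is recorded by the family of rows of t. *)
Definition rows_of (t : tableau) : {ffun 'I_(size la) -> {set 'I_n}} :=
  [ffun i => tableau_row t (val i)].

Definition tabloid : finType :=
  {T : {ffun 'I_(size la) -> {set 'I_n}} | [exists t, T == rows_of t]}.

Fact tabloid_of_subproof (t : tableau) : [exists u, rows_of t == rows_of u].
Proof. by apply/existsP; exists t. Qed.

Definition tabloid_of (t : tableau) : tabloid :=
  Sub (rows_of t) (tabloid_of_subproof t).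

Lemma rows_of_move (s : 'S_n) (t : tableau) :
  rows_of (move_tableau s t) = [ffun i => s @: rows_of t i].
Proof.
apply/ffunP => i; rewrite !ffunE -imset_comp.
by apply: eq_imset => c; rewrite /fill /= ffunE.
Qed.

Fact move_tabloid_subproof (s : 'S_n) (T : tabloid) :
  [exists t, [ffun i => s @: val T i] == rows_of t].
Proof.
have /existsP[t /eqP ->] := valP T.
by apply/existsP; exists (move_tableau s t); rewrite rows_of_move.
Qed.

Definition move_tabloid (s : 'S_n) (T : tabloid) : tabloid :=
  Sub [ffun i => s @: val T i] (move_tabloid_subproof s T).

Lemma move_tabloid_of (s : 'S_n) (t : tableau) :
  move_tabloid s (tabloid_of t) = tabloid_of (move_tableau s t).
Proof. by apply: val_inj; rewrite /= rows_of_move. Qed.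

(* The free Z-module on the tabloids, as coefficient functions. *)
Definition perm_module : zmodType := {ffun tabloid -> int}.

Definition tabloid_basis (T : tabloid) : perm_module :=
  [ffun U => ((U == T)%:R : int)].

(* Permutations compose from left to right in MathComp, so that moving tabloids
   is a right action and precomposing coefficient functions with it is a left
   action; s sends the basis element T to s^-1 T, i.e. this is the usual left
   module transported along the isomorphism s |-> s^-1 between the two
   conventions for the product of permutations. *)
Definition perm_act (s : 'S_n) (v : perm_module) : perm_module :=
  [ffun T => v (move_tabloid s T)].

Definition col_stab (t : tableau) : {set 'S_n} :=
  [set s : 'S_n | [forall j : 'I_n, s @: tableau_col t j == tableau_col t j]].

Definition polytabloid (t : tableau) : perm_module :=
  \sum_(s in col_stab t) tabloid_basis (tabloid_of (move_tableau s t)) *~ (-1) ^+ s.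

(* The Z-span of the polytabloids; it is stable under 'S_n since s maps the
   polytabloid of t to that of s^-1 t, see specht_act_subproof. *)
Definition in_specht : {pred perm_module} :=
  [pred v | `[< exists c : {ffun tableau -> int},
                  v = \sum_t polytabloid t *~ c t >]].

Lemma in_specht_closed : zmod_closed in_specht.
Proof.
split=> [|v w]; rewrite !inE.
  by apply/asboolP; exists 0; rewrite big1 // => t _; rewrite ffunE.
move=> /asboolP[c ->] /asboolP[d ->]; apply/asboolP; exists (c - d).
by rewrite -sumrB; apply: eq_bigr => t _; rewrite !ffunE mulrzBr.
Qed.

HB.instance Definition _ :=
  GRing.isZmodClosed.Build perm_module in_specht in_specht_closed.

Record specht :=
  Specht { specht_val :> perm_module; _ : specht_val \in in_specht }.

HB.instance Definition _ := [isSub for specht_val].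
HB.instance Definition _ := [Choice of specht by <:].
HB.instance Definition _ := [SubChoice_isSubZmodule of specht by <:].

Lemma perm_act1 v : perm_act 1%g v = v.
Proof.
apply/ffunP => T; rewrite ffunE; congr (v _); apply: val_inj.
apply/ffunP => i; rewrite ffunE -[RHS]imset_id.
by apply: eq_imset => x; rewrite perm1.
Qed.

Lemma perm_actM s s' v : perm_act (s * s')%g v = perm_act s (perm_act s' v).
Proof.
apply/ffunP => T; rewrite !ffunE; congr (v _); apply: val_inj.
apply/ffunP => i; rewrite !ffunE -imset_comp.
by apply: eq_imset => x; rewrite permM.
Qed.

Lemma perm_actB s v w : perm_act s (v - w) = perm_act s v - perm_act s w.
Proof. by apply/ffunP => T; rewrite !ffunE. Qed.

HB.instance Definition _ s :=
  GRing.isZmodMorphism.Build perm_module perm_module (perm_act s) (perm_actB s).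

Lemma perm_act_basis s t :
  perm_act s (tabloid_basis (tabloid_of t)) =
  tabloid_basis (tabloid_of (move_tableau s^-1 t)).
Proof.
apply/ffunP => T; rewrite !ffunE -move_tabloid_of; congr ((nat_of_bool _)%:R).
have K g h U : move_tabloid g (move_tabloid h U) = move_tabloid (h * g)%g U.
  apply: val_inj; apply/ffunP => i; rewrite !ffunE -imset_comp.
  by apply: eq_imset => x; rewrite permM.
have I U : move_tabloid 1%g U = U.
  apply: val_inj; apply/ffunP => i; rewrite ffunE -[RHS]imset_id.
  by apply: eq_imset => x; rewrite perm1.
by apply/eqP/eqP => [<- | ->]; rewrite K (mulgV, mulVg) I.
Qed.

Lemma tableau_col_move s t j :
  tableau_col (move_tableau s t) j = s @: tableau_col t j.
Proof.
by rewrite -imset_comp; apply: eq_imset => c; rewrite /fill /= ffunE.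
Qed.

Lemma move_tableauM s s' t :
  move_tableau (s * s')%g t = move_tableau s' (move_tableau s t).
Proof.
by apply: val_inj; apply/ffunP => c; rewrite /= !ffunE /fill /= ffunE permM.
Qed.

Lemma move_tableauK s : cancel (move_tableau s) (move_tableau s^-1).
Proof.
move=> t; apply: val_inj; apply/ffunP => c.
by rewrite /= ffunE /fill /= ffunE permK.
Qed.

Lemma col_stab_move s t : col_stab (move_tableau s t) = (col_stab t :^ s)%g.
Proof.
apply/setP => g; rewrite mem_conjg !inE; apply: eq_forallb => j.
rewrite tableau_col_move.
have sI := imset_inj (@perm_inj _ s).
rewrite -[in RHS](inj_eq sI); congr (_ == _).
rewrite -[RHS]imset_comp -[LHS]imset_comp; apply: eq_imset => x /=.
by rewrite conjgE invgK !permM permKV.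
Qed.

Lemma perm_act_polytabloid s t :
  perm_act s (polytabloid t) = polytabloid (move_tableau s^-1 t).
Proof.
rewrite /polytabloid raddf_sum /= col_stab_move.
rewrite [RHS](reindex_inj (conjg_inj s^-1%g)) /=.
apply: eq_big => [g | g _]; first by rewrite memJ_conjg.
rewrite raddfMz /= perm_act_basis odd_permJ -!move_tableauM.
by rewrite conjgE invgK !mulgA mulVg mul1g.
Qed.

Fact specht_act_subproof s (v : specht) : perm_act s (val v) \in in_specht.
Proof.
have := valP v; rewrite !inE => /asboolP[c ->]; apply/asboolP.
exists [ffun t => c (move_tableau s t)].
rewrite raddf_sum /= (reindex_inj (can_inj (move_tableauK s))) /=.
apply: eq_bigr => t _.
by rewrite raddfMz /= perm_act_polytabloid move_tableauK [in RHS]ffunE.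
Qed.

Definition specht_act (s : 'S_n) (v : specht) : specht :=
  Specht (specht_act_subproof s v).

Fact specht_act1 v : specht_act 1%g v = v.
Proof. by apply: val_inj; rewrite /= perm_act1. Qed.

Fact specht_actM s s' v :
  specht_act (s * s')%g v = specht_act s (specht_act s' v).
Proof. by apply: val_inj; rewrite /= perm_actM. Qed.

Fact specht_actB s v w :
  specht_act s (v - w) = specht_act s v - specht_act s w.
Proof. by apply: val_inj; rewrite /= perm_actB. Qed.

Definition specht_module : gmodule 'S_n specht :=
  GModule specht_act1 specht_actM specht_actB.

Definition H2_specht : zmodType := H2 specht_module.

End Specht.

Definition C2 (p : nat) (la : seq nat) : Prop :=
  is_partition la /\ dvd_order p (H2_specht la).

(* The padding that incr_nth inserts when i > size la is ruled out by the
   partition condition on mu. *)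
Definition adds_node (la mu : seq nat) : Prop :=
  [/\ is_partition la, is_partition mu & exists i, mu = incr_nth la i].

(* la is a predecessor of mu. *)
Definition predecessor (p : nat) (la mu : seq nat) : Prop :=
  [/\ C2 p la, C2 p mu & adds_node la mu].

(* Main.v *)
From HB Require Import structures.
Require Import Defs.
From mathcomp Require Import all_boot all_order all_fingroup all_algebra.
From mathcomp Require Import all_solvable.
From mathcomp Require Import boolp zify ring.

Set Implicit Arguments.
Unset Strict Implicit.
Unset Printing Implicit Defensive.

Import GRing.Theory Num.Theory.
Local Open Scope ring_scope.
Local Open Scope quotient_scope.

(** Write n for the size of the partition. The Specht module of the hook
    (n - k, 1^k) is the module of cycles of degree k in the complex of
    alternating integer functions on tuples of the n points, with differential
    the sum over the first entry: the polytabloid of a tableau is the image of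
    the alternating basis function of its first column
    ([leg_fun_polytabloid]), and the complex, that of a simplex, is exact
    ([bd_cone]). In other words it is the k-th exterior power of the
    augmentation kernel S of Z^n, and there are exact sequences
      0 -> L^k S -> L^k Z^n -> L^(k-1) S -> 0.

    Away from a few small primes these sequences shift cohomology. For k >= 2
    the alternating functions have no cohomology after 2k(k-1) is inverted,
    since the transposition of two entries of a tuple both acts trivially on
    cohomology and changes signs ([alt_cocycle1], [alt_cocycle2]); and
    2 H^2(Z^n) = 2 H^1(Z^n) = 0 by Shapiro's lemma, as homomorphisms from a
    symmetric group to an abelian group are 2-torsion ([crossed_mod]). Hence
      - for k = 0 and k = 1, H^2 is killed by 2;
      - for k = 2, H^2 agrees at odd primes with H^1(S), the cokernel of the
        multiplication by n on the integers, so that its p-part is cyclic of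
        the order of the p-part of n ([hook2_class], [H2_hook2_embed]);
      - for k >= 3, H^2 is shifted to the invariants of L^(k-2) S, which
        vanish ([hook3_cocycle2]), so that H^2 has no p-torsion when k < p.

    This gives the criterion and the p-rank. A predecessor of (n-2, 1^2) would
    be (n-2, 1), or (n-3, 1^2) with p dividing n - 1, which is impossible. There
    remain the partitions of p that are not hooks. A central element of the
    group ring acts on cohomology both by its scalar on the Specht module and by
    its augmentation ([H2_central_kill]). The element with coefficient
    N ^ (number of cycles of g) at g acts on the Specht module by the product
    of N + (content) over the nodes, and has augmentation
    N (N + 1) ... (N + p - 1): it is the product of the N + J over the
    Jucys-Murphy elements J ([jucys_murphy]), of which polytabloids are common
    eigenvectors by the Garnir relations ([jucys_murphy_polytabloid]). If N is
    the number of rows, p divides the augmentation, but not the scalar, the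
    hook length of the corner node being less than p ([H2_non_hook]). *)

(** * Permutations fixing a set of points *)

Lemma perm_on_tperm (T : finType) (A : {set T}) a b :
  a \in A -> b \in A -> perm_on A (tperm a b).
Proof.
move=> aA bA; apply/subsetP => y; rewrite inE.
by case: tpermP => [->|->|]; rewrite ?eqxx.
Qed.

(** Induction on the number of moved points: multiplying by the transposition of
    a moved point with its preimage fixes that point. *)
Lemma perm_on_ind (T : finType) (A : {set T}) (P : {perm T} -> Prop) :
    P 1%g ->
    (forall a b s, a \in A -> b \in A -> a != b -> perm_on A s -> P s ->
       P (tperm a b * s)%g) ->
  forall s, perm_on A s -> P s.
Proof.
move=> P1 PM s; have [m] := ubnP #|[set x | s x != x]|.
elim: m s => // m IHm s; rewrite ltnS => le_m sA.
have [/eqP s0|[x]] := set_0Vmem [set x | s x != x].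
  suff -> : s = 1%g by [].
  apply/permP => x; rewrite perm1; apply/eqP; apply: contraT => sx.
  by move/eqP/setP/(_ x): s0; rewrite !inE sx.
rewrite inE => sx; have xA : x \in A by apply: contraR sx => /(out_perm sA)->.
set x' := (s^-1 x)%g; have sx' : s x' = x by rewrite permKV.
have x'A : x' \in A by rewrite -(perm_closed _ sA) sx'.
have xx' : x != x' by apply: contra sx => /eqP {1}->; rewrite sx'.
have -> : s = (tperm x x' * (tperm x x' * s))%g by rewrite mulgA tperm2 mul1g.
have tsA : perm_on A (tperm x x' * s)%g.
  by apply: perm_onM => //; apply: perm_on_tperm.
apply: PM => //; apply: IHm => //; apply: leq_trans le_m.
apply: proper_card; apply/properP; split; last first.
  by exists x; rewrite !inE // permM tpermL sx' eqxx.
apply/subsetP => y; rewrite !inE permM.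
case: tpermP => [->|-> _|//]; first by rewrite sx' eqxx.
by apply: contra xx' => /eqP; rewrite sx' => ->.
Qed.

(** Transpositions are involutions and generate the symmetric group, so twice a
    homomorphism to an abelian group vanishes. Here [S] stands for the subgroup
    modulo which [u] is a homomorphism. *)
Lemma perm_on_hom_mod (T : finType) (A : {set T}) (M : zmodType)
    (S : M -> Prop) (u : {perm T} -> M) :
    S 0 -> (forall x y, S x -> S y -> S (x - y)) ->
    (forall s t, perm_on A s -> perm_on A t -> S (u (s * t)%g - u s - u t)) ->
  forall s, perm_on A s -> S (u s *+ 2).
Proof.
move=> S0 SB uM.
have SN x : S x -> S (- x) by rewrite -sub0r; apply: SB.
have SD x y : S x -> S y -> S (x + y).
  by move=> Sx Sy; rewrite -[y]opprK; apply/SB/SN.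
have S1 : S (u 1%g).
  rewrite -[u _]opprK; apply: SN.
  by have := uM 1%g 1%g (perm_on1 A) (perm_on1 A); rewrite mulg1 subrr sub0r.
apply: perm_on_ind => [|a b s aA bA _ sA IHs].
  by rewrite mulr2n; apply: SD.
have tA := perm_on_tperm aA bA.
have St : S (u (tperm a b) *+ 2).
  have := SB _ _ S1 (uM _ _ tA tA); rewrite tperm2 !opprD !opprK.
  by rewrite !addrA subrr add0r mulr2n.
have -> : u (tperm a b * s)%g *+ 2 =
    (u (tperm a b * s)%g - u (tperm a b) - u s) *+ 2
    + u (tperm a b) *+ 2 + u s *+ 2.
  by rewrite -!mulrnDl (addrAC _ (- u s)) !subrK.
by apply/SD => //; apply/SD => //; rewrite mulr2n; apply/SD; apply: uM.
Qed.

(** * The complex of alternating functions *)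

Section Alternating.

Variable T : finType.
Implicit Types (g h : {perm T}) (a b o : T).

Definition tup k := {ffun 'I_k -> T}.

Definition mv k g (x : tup k) : tup k := [ffun i => g (x i)].
Definition sw k (i j : 'I_k) (x : tup k) : tup k := [ffun l => x (tperm i j l)].
Definition upd k (x : tup k) (i : 'I_k) a : tup k :=
  [ffun l => if l == i then a else x l].
Definition tcons k a (x : tup k) : tup k.+1 :=
  [ffun l => if unlift ord0 l is Some i then x i else a].
Definition ttail k (x : tup k.+1) : tup k := [ffun i => x (lift ord0 i)].

Lemma mvM k g h (x : tup k) : mv (g * h)%g x = mv h (mv g x).
Proof. by apply/ffunP => i; rewrite !ffunE permM. Qed.

Lemma mv1 k (x : tup k) : mv 1%g x = x.
Proof. by apply/ffunP => i; rewrite !ffunE perm1. Qed.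

Lemma mv_sw k g i j (x : tup k) : mv g (sw i j x) = sw i j (mv g x).
Proof. by apply/ffunP => l; rewrite !ffunE. Qed.

Lemma tcons0 k a (x : tup k) : tcons a x ord0 = a.
Proof. by rewrite ffunE unlift_none. Qed.

Lemma tconsS k a (x : tup k) i : tcons a x (lift ord0 i) = x i.
Proof. by rewrite ffunE liftK. Qed.

Lemma ttail_cons k a (x : tup k) : ttail (tcons a x) = x.
Proof. by apply/ffunP => i; rewrite ffunE tconsS. Qed.

Lemma tcons_tail k (x : tup k.+1) : tcons (x ord0) (ttail x) = x.
Proof.
by apply/ffunP => i; rewrite ffunE; case: unliftP => [j|] ->; rewrite ?ffunE.
Qed.

Lemma mv_cons k g a (x : tup k) : mv g (tcons a x) = tcons (g a) (mv g x).
Proof.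
by apply/ffunP => i; rewrite !ffunE; case: unliftP => [j|] _; rewrite ?ffunE.
Qed.

Lemma lift0_tperm k (i j l : 'I_k) :
  tperm (lift ord0 i) (lift ord0 j) (lift ord0 l) = lift ord0 (tperm i j l).
Proof. by rewrite (inj_tperm i j l (@lift_inj _ ord0)). Qed.

Lemma sw_cons k (i j : 'I_k) a (x : tup k) :
  tcons a (sw i j x) = sw (lift ord0 i) (lift ord0 j) (tcons a x).
Proof.
apply/ffunP => l; rewrite [RHS]ffunE; case: (unliftP ord0 l) => [m|] ->.
  by rewrite lift0_tperm !tconsS ffunE.
by rewrite tpermD ?tcons0 // eq_sym neq_lift.
Qed.

Lemma ttail_sw k (i j : 'I_k) (x : tup k.+1) :
  ttail (sw (lift ord0 i) (lift ord0 j) x) = sw i j (ttail x).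
Proof. by apply/ffunP => l; rewrite !ffunE lift0_tperm. Qed.

Definition alt k (v : tup k -> int) : Prop :=
  forall i j x, i != j -> v (sw i j x) = - v x.

Lemma alt_eq0 k (v : tup k -> int) i j (x : tup k) :
  alt v -> i != j -> x i = x j -> v x = 0.
Proof.
move=> va ij xij; have := va i j x ij; have -> : sw i j x = x; last by lia.
by apply/ffunP => l; rewrite ffunE; case: tpermP => [->|->|].
Qed.

Lemma alt_ninj k (v : tup k -> int) (x : tup k) :
  alt v -> ~~ injectiveb x -> v x = 0.
Proof.
by move=> va /injectivePn[i [j ij xij]]; apply: (alt_eq0 va ij xij).
Qed.

Lemma mv_injectiveb k g (x : tup k) : injectiveb (mv g x) = injectiveb x.
Proof.
apply/injectiveP/injectiveP => xI i j e; apply: xI.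
  by rewrite !ffunE e.
by move: e; rewrite !ffunE => /perm_inj.
Qed.

Lemma mv_tperm k (x : tup k) i j :
  injectiveb x -> mv (tperm (x i) (x j)) x = sw i j x.
Proof.
move/injectiveP => xI; apply/ffunP => l.
by rewrite !ffunE (inj_tperm i j l xI).
Qed.

(** The same rule on values instead of positions, which is how a transposition
    of two entries acts: for distinct entries the two agree, and both sides
    vanish at a tuple with a repeated entry. *)
Lemma alt_tperm k (v : tup k -> int) i j (x : tup k) :
  alt v -> i != j -> v (mv (tperm (x i) (x j)) x) = - v x.
Proof.
move=> va ij; have [xI|xNI] := boolP (injectiveb x).
  by rewrite mv_tperm // va.
by rewrite !(alt_ninj va) // mv_injectiveb.
Qed.

(** The contraction with the all-one functional: the differential of the
    complex, which is that of a simplex on the points of [T]. *)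
Definition bd k (v : tup k.+1 -> int) (x : tup k) : int := \sum_a v (tcons a x).

Lemma bd_alt k (v : tup k.+1 -> int) : alt v -> alt (bd v).
Proof.
move=> va i j x ij; rewrite /bd -sumrN; apply: eq_bigr => a _.
by rewrite sw_cons va // (inj_eq lift_inj).
Qed.

Lemma bd_mv k (v : tup k.+1 -> int) g x :
  bd v (mv g x) = \sum_a v (mv g (tcons a x)).
Proof.
rewrite /bd (reindex_inj (@perm_inj _ g)); apply: eq_bigr => a _.
by rewrite mv_cons.
Qed.

Lemma bdD k (u v : tup k.+1 -> int) x :
  bd (fun y => u y + v y) x = bd u x + bd v x.
Proof. exact: big_split. Qed.

Lemma bdN k (v : tup k.+1 -> int) x : bd (fun y => - v y) x = - bd v x.
Proof. exact: sumrN. Qed.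

Lemma bdB k (u v : tup k.+1 -> int) x :
  bd (fun y => u y - v y) x = bd u x - bd v x.
Proof. by rewrite bdD bdN. Qed.

Lemma bdZ k c (v : tup k.+1 -> int) x : bd (fun y => c * v y) x = c * bd v x.
Proof. by rewrite /bd mulr_sumr. Qed.

Lemma eq_bd k (u v : tup k.+1 -> int) x : u =1 v -> bd u x = bd v x.
Proof. by move=> e; apply: eq_bigr. Qed.

Lemma bd_bd k (v : tup k.+2 -> int) x : alt v -> bd (bd v) x = 0.
Proof.
move=> va; suff : bd (bd v) x = - bd (bd v) x by lia.
rewrite {1}/bd exchange_big /= -sumrN; apply: eq_bigr => a _.
rewrite -sumrN; apply: eq_bigr => b _.
rewrite -(va ord0 (lift ord0 ord0)) //; congr v; apply/ffunP => l.
rewrite [RHS]ffunE; case: tpermP => [->|->|]; rewrite ?(tcons0, tconsS) //.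
case: (unliftP ord0 l) => [m|] -> //; rewrite !tconsS.
by case: (unliftP ord0 m) => [m'|] ->; rewrite ?tconsS.
Qed.

Lemma updE k (x : tup k) i a l : upd x i a l = if l == i then a else x l.
Proof. by rewrite ffunE. Qed.

(** The exterior product of [w] with the indicator of the point [o], written so
    that no order of the entries is chosen. *)
Definition cone k o (w : tup k.+1 -> int) (z : tup k.+2) : int :=
  (z ord0 == o)%:R * w (ttail z)
  - \sum_i (ttail z i == o)%:R * w (upd (ttail z) i (z ord0)).

Lemma upd_cons k a b (x : tup k) : upd (tcons a x) ord0 b = tcons b x.
Proof.
by apply/ffunP => l; rewrite !ffunE; case: unliftP => [m|] ->.
Qed.

Lemma sw_upd k (x : tup k) i j l a : 
  upd (sw i j x) l a = sw i j (upd x (tperm i j l) a).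
Proof.
by apply/ffunP => m; rewrite !ffunE (can2_eq (tpermK i j) (tpermK i j)) tpermK.
Qed.

(** Up to sign, summing over the value of one entry is the contraction. *)
Lemma sum_upd k (w : tup k.+1 -> int) (x : tup k.+1) i :
  alt w -> (forall y, bd w y = 0) -> \sum_a w (upd x i a) = 0.
Proof.
move=> wa w0; case: (unliftP ord0 i) => [j|] ->; last first.
  rewrite -[RHS](w0 (ttail x)); apply: eq_bigr => a _.
  by rewrite -[x]tcons_tail upd_cons ttail_cons.
set y := sw ord0 (lift ord0 j) x; have -> : x = sw ord0 (lift ord0 j) y.
  by apply/ffunP => l; rewrite !ffunE tpermK.
apply: oppr_inj; rewrite oppr0 -[RHS](w0 (ttail y)) -sumrN.
apply: eq_bigr => a _; rewrite sw_upd tpermR wa // opprK.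
by rewrite -[y in upd y]tcons_tail upd_cons.
Qed.

Lemma cone_alt k o (w : tup k.+1 -> int) : alt w -> alt (cone o w).
Proof.
move=> wa.
have alt0 j z : cone o w (sw ord0 (lift ord0 j) z) = - cone o w z.
  set x := ttail z; set a := z ord0.
  rewrite /cone; have -> : ttail (sw ord0 (lift ord0 j) z) = upd x j a.
    apply/ffunP => l; rewrite !ffunE; have [->|lj] := eqVneq l j.
      by rewrite tpermR.
    by rewrite tpermD ?(inj_eq lift_inj) // eq_sym.
  have -> : sw ord0 (lift ord0 j) z ord0 = x j by rewrite !ffunE tpermL.
  rewrite -/x -/a (bigD1 j) //= [in RHS](bigD1 j) //= updE eqxx.
  have -> : upd (upd x j a) j (x j) = x.
    by apply/ffunP => l; rewrite !ffunE; case: eqP => // ->.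
  rewrite [X in _ - (_ + X)](_ : _ = - \sum_(i | i != j)
      (x i == o)%:R * w (upd x i a)); first by ring.
  rewrite -sumrN; apply: eq_bigr => l lj; rewrite updE (negPf lj) -mulrN.
  congr (_ * _); rewrite -(wa j l) 1?eq_sym //; congr w; apply/ffunP => m.
  have jl : (j == l) = false by rewrite eq_sym (negPf lj).
  rewrite !ffunE; case: tpermP => [->|->|].
  - by rewrite !eqxx jl.
  - by rewrite eqxx jl.
  - by move=> /eqP/negPf -> /eqP/negPf ->.
move=> i j z ij; case: (unliftP ord0 i) ij => [i'|] -> ij; last first.
  by case: (unliftP ord0 j) ij => [j'|] -> // _; apply: alt0.
case: (unliftP ord0 j) ij => [j'|] -> ij; last first.
  rewrite -(alt0 i'); congr (cone o w _).
  by apply/ffunP=> l; rewrite !ffunE tpermC.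
rewrite (inj_eq lift_inj) in ij; rewrite /cone ttail_sw wa //.
have -> : sw (lift ord0 i') (lift ord0 j') z ord0 = z ord0.
  by rewrite ffunE tpermD // eq_sym neq_lift.
rewrite [X in _ - X](_ : _ = - \sum_l
   (ttail z l == o)%:R * w (upd (ttail z) l (z ord0))); first by ring.
rewrite -sumrN [RHS](reindex_inj (@perm_inj _ (tperm i' j'))).
by apply: eq_bigr => l _; rewrite sw_upd wa // mulrN ffunE.
Qed.

(** The complex of alternating functions is exact: it is the chain complex of
    a simplex, contracted by the cone over [o]. *)
Lemma bd_cone k o (w : tup k.+1 -> int) x :
  alt w -> (forall y, bd w y = 0) -> bd (cone o w) x = w x.
Proof.
move=> wa w0; rewrite /bd /cone sumrB exchange_big /= [X in _ - X]big1.
  rewrite subr0 (bigD1 o) //= tcons0 eqxx mul1r ttail_cons big1 ?addr0 //.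
  by move=> a /negPf ao; rewrite tcons0 ao mul0r.
move=> i _; under eq_bigr do rewrite ttail_cons tcons0.
by rewrite -mulr_sumr sum_upd // mulr0.
Qed.

(** * Cochains with values in the complex *)

Definition d0 k (v : tup k -> int) g x : int := v (mv g x) - v x.

Definition d1 k (u : {perm T} -> tup k -> int) g h x : int :=
  u h (mv g x) - u (g * h)%g x + u g x.

Definition d2 k (f : {perm T} -> {perm T} -> tup k -> int) g h l x : int :=
  f h l (mv g x) - f (g * h)%g l x + f g (h * l)%g x - f g h x.

Lemma d1_d0 k (v : tup k -> int) g h x : d1 (d0 v) g h x = 0.
Proof. by rewrite /d1 /d0 -!mvM; ring. Qed.

Lemma d2_d1 k (u : {perm T} -> tup k -> int) g h l x : d2 (d1 u) g h l x = 0.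
Proof. by rewrite /d2 /d1 -!mvM !mulgA; ring. Qed.

Lemma bd_d0 k (v : tup k.+1 -> int) g x : bd (d0 v g) x = d0 (bd v) g x.
Proof. by rewrite /d0 bd_mv [LHS]sumrB. Qed.

Lemma bd_d1 k (u : {perm T} -> tup k.+1 -> int) g h x :
  bd (d1 u g h) x = d1 (fun l => bd (u l)) g h x.
Proof. by rewrite /d1 bd_mv [LHS]big_split sumrB. Qed.

Definition tr k (i j : 'I_k) (x : tup k) : {perm T} := tperm (x i) (x j).

Lemma tr_mv k g i j (x : tup k) : (g * tr i j (mv g x) = tr i j x * g)%g.
Proof. by rewrite /tr !ffunE -tpermJ conjgE mulgA mulgV mul1g. Qed.

Lemma tr_sw k (t s i j : 'I_k) (x : tup k) :
  tr i j (sw t s x) = tr (tperm t s i) (tperm t s j) x.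
Proof. by rewrite /tr !ffunE. Qed.

(** The exponent of the cohomology of alternating functions found below: twice
    the number of ordered pairs of distinct positions. *)
Definition signc k : nat := (k * k.-1).*2.

Lemma sum_pairs k (c : int) :
  \sum_(i < k) \sum_(j < k | j != i) 2 * c = (signc k)%:Z * c.
Proof.
under eq_bigr => i _.
  rewrite sumr_const (_ : #|_| = k.-1); first over.
  by rewrite (eq_card (B := predC1 i)) // cardC1 card_ord.
by rewrite sumr_const card_ord -mulrnA /signc -mul2n; lia.
Qed.

Lemma sum_pairs_sw k (t s : 'I_k) (F : 'I_k -> 'I_k -> int) :
  \sum_i \sum_(j | j != i) F (tperm t s i) (tperm t s j) =
  \sum_i \sum_(j | j != i) F i j.
Proof.
rewrite [RHS](reindex_inj (@perm_inj _ (tperm t s))); apply: eq_bigr => i _.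
rewrite [RHS](reindex_inj (@perm_inj _ (tperm t s))); apply: eq_bigl => j.
by rewrite (inj_eq perm_inj).
Qed.

(** Conjugation acts trivially on cohomology, whereas the transposition of two
    entries of [x] changes the sign of the value at [x]. Summing over all pairs
    of entries keeps the homotopy alternating, at the cost of their number. *)
Lemma alt_cocycle1 k (u : {perm T} -> tup k -> int) :
    (forall g, alt (u g)) -> (forall g h x, d1 u g h x = 0) ->
  exists2 v, alt v & forall g x, (signc k)%:Z * u g x = d0 v g x.
Proof.
move=> ua u0; exists (fun x => \sum_i \sum_(j | j != i) - u (tr i j x) x).
  move=> t s x ts; rewrite -sumrN; under [RHS]eq_bigr do rewrite -sumrN.
  rewrite -(sum_pairs_sw t s (fun i j => - - u (tr i j x) x)).
  apply: eq_bigr => i _; apply: eq_bigr => j ij.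
  by rewrite tr_sw ua.
move=> g x; rewrite -sum_pairs /d0 -sumrB; apply: eq_bigr => i _.
rewrite -sumrB; apply: eq_bigr => j; rewrite eq_sym => ij.
have := u0 g (tr i j (mv g x)) x; have := u0 (tr i j x) g x.
by rewrite /d1 tr_mv (alt_tperm _ (ua g) ij); lia.
Qed.

(** The same argument one degree higher, with the homotopy
    f(g, s ^ g) - f(s, g) of the bar complex for the conjugation by s. *)
Lemma alt_cocycle2 k (f : {perm T} -> {perm T} -> tup k -> int) :
    (forall g h, alt (f g h)) -> (forall g h l x, d2 f g h l x = 0) ->
  exists2 u, forall g, alt (u g)
    & forall g h x, (signc k)%:Z * f g h x = d1 u g h x.
Proof.
move=> fa f0; exists (fun g x => \sum_i \sum_(j | j != i)
    (f g (tr i j (mv g x)) x - f (tr i j x) g x)).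
  move=> g t s x ts; rewrite -sumrN; under [RHS]eq_bigr do rewrite -sumrN.
  rewrite -(sum_pairs_sw t s
    (fun i j => - (f g (tr i j (mv g x)) x - f (tr i j x) g x))).
  apply: eq_bigr => i _; apply: eq_bigr => j ij.
  by rewrite mv_sw !tr_sw !fa //; ring.
move=> g h x; rewrite -sum_pairs /d1 -sumrB -big_split; apply: eq_bigr => i _.
rewrite -sumrB -big_split; apply: eq_bigr => j; rewrite eq_sym => ij /=.
have := f0 g (tr i j (mv g x)) h x; have := f0 (tr i j x) g h x.
have := f0 g h (tr i j (mv h (mv g x))) x.
rewrite /d2 (tr_mv g) (tr_mv h) !(alt_tperm _ (fa _ _) ij) -!mvM; lia.
Qed.

(** The cycles of the complex; on [k.+1]-tuples they form the Specht module
    of the hook with leg length [k.+1]. *)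
Definition inL k (v : tup k.+1 -> int) : Prop := alt v /\ forall x, bd v x = 0.

Lemma alt1 (v : tup 1 -> int) : alt v.
Proof. by move=> i j x; rewrite (ord1 i) (ord1 j). Qed.

Lemma mv0 g (x : tup 0) : mv g x = x.
Proof. by apply/ffunP => -[]. Qed.

Lemma eq_tup1 (x y : tup 1) : x ord0 = y ord0 -> x = y.
Proof. by move=> xy; apply/ffunP => i; rewrite (ord1 i). Qed.

(** Shapiro: by transitivity, a crossed homomorphism into the functions on the
    points is given by its values at one point, on the stabiliser of that
    point; there it is a homomorphism, hence 2-torsion. *)
Lemma crossed_mod N (u : {perm T} -> tup 1 -> int) :
    (forall g h x, (N %| d1 u g h x)%Z) ->
  exists v, forall g x, (N %| 2 * u g x - d0 v g x)%Z.
Proof.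
move=> uN; have [o _|T0] := pickP T; last first.
  by exists (fun=> 0) => g x; have := T0 (x ord0).
pose x0 : tup 1 := [ffun=> o]; pose t (y : tup 1) := tperm o (y ord0).
have tE y : mv (t y) x0 = y by apply: eq_tup1; rewrite !ffunE tpermL.
pose v y := 2 * u (t y) x0.
have vE g : (N %| 2 * u g x0 - v (mv g x0))%Z.
  pose y := mv g x0; pose s := (g * (t y)^-1)%g.
  have sx0 : mv s x0 = x0 by rewrite mvM -/y -{2}(tE y) -mvM mulgV mv1.
  have sA : perm_on [set~ o] s.
    apply/subsetP => a; rewrite !inE; apply: contra => /eqP ->.
    by apply/eqP; have /ffunP/(_ ord0) := sx0; rewrite !ffunE.
  have Afix h : perm_on [set~ o] h -> mv h x0 = x0.
    by move=> hA; apply: eq_tup1; rewrite !ffunE (out_perm hA) // !inE eqxx.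
  have [|||q sq] := dvdzP (@perm_on_hom_mod _ _ _ (fun c => N %| c)%Z
    (u^~ x0) _ _ _ _ sA); rewrite ?dvdz0 //; first by move=> *; apply: rpredB.
    move=> g1 g2 g1A g2A; have /dvdzP[q guq] := uN g1 g2 x0; apply/dvdzP.
    by exists (- q); move: guq; rewrite /d1 Afix //; lia.
  have /dvdzP[r] := uN s (t y) x0; rewrite /d1 sx0 mulgKV => gr.
  by apply/dvdzP; exists (q - 2 * r); rewrite /v -/y; move: sq => /=; lia.
exists v => g x; have /dvdzP[q] := vE (t x * g)%g; rewrite mvM tE => gq.
have /dvdzP[r] := uN (t x) g x0; rewrite /d1 tE => gr.
by apply/dvdzP; exists (q + 2 * r); rewrite /d0 /v; rewrite /v in gq; lia.
Qed.

(** Averaging over the group makes [f] a coboundary after multiplication by the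
    order N of the group, of a cochain that is a crossed homomorphism modulo N;
    twice the latter is a coboundary modulo N, and the difference is divided
    by N. *)
Lemma points_cocycle2 (f : {perm T} -> {perm T} -> tup 1 -> int) :
    (forall g h l x, d2 f g h l x = 0) ->
  exists u, forall g h x, 2 * f g h x = d1 u g h x.
Proof.
move=> f0; set N := #|{perm T}|%:Z.
have N0 : N != 0 by rewrite eqz_nat -lt0n; apply/card_gt0P; exists 1%g.
pose h0 g x := \sum_k f g k x.
have h0E g h x : d1 h0 g h x = N * f g h x.
  rewrite /d1 /h0 [X in _ + X](reindex_inj (mulgI h)) -sumrB -big_split /=.
  under eq_bigr => k _.
    rewrite (_ : _ + _ = f g h x); first over.
    by apply/eqP; rewrite -subr_eq0; apply/eqP; apply: f0.
  by rewrite sumr_const -mulr_natl natz.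
have [|v vE] := @crossed_mod N h0.
  by move=> g h x; rewrite h0E dvdz_mulr.
pose w g x := ((2 * h0 g x - d0 v g x) %/ N)%Z.
have wE g x : N * w g x = 2 * h0 g x - d0 v g x by rewrite mulrC divzK.
exists w => g h x; apply: (mulfI N0); rewrite mulrCA -h0E.
transitivity (N * w h (mv g x) - N * w (g * h)%g x + N * w g x).
  by rewrite !wE; have := d1_d0 v g h x; rewrite /d1; lia.
by rewrite /d1; ring.
Qed.

(** The sum over the points of the cochain found in [points_cocycle2] is a
    homomorphism to the integers, hence zero. *)
Lemma hook1_cocycle2 (f : {perm T} -> {perm T} -> tup 1 -> int) :
    (forall g h, inL (f g h)) -> (forall g h l x, d2 f g h l x = 0) ->
  exists2 u, forall g, inL (u g) & forall g h x, 2 * f g h x = d1 u g h x.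
Proof.
move=> fL f0; have [u uE] := points_cocycle2 f0; exists u => // g.
split=> [|x]; first exact: alt1.
suff : bd (u g) x *+ 2 = 0 by lia.
apply: (@perm_on_hom_mod _ setT _ (fun c => c = 0) (fun g => bd (u g) x)) => //.
- by move=> a b -> ->.
- 2: by apply/subsetP => a; rewrite inE.
move=> s t _ _; have := bd_d1 u s t x; rewrite /d1 mv0.
rewrite (eq_bd (v := fun y => 2 * f s t y)); last by move=> y; rewrite uE.
by rewrite bdZ (fL s t).2; lia.
Qed.

(** An invariant alternating function vanishes by transposing two entries; in
    degree one it is constant, and its sum is zero. *)
Lemma inv_inL_eq0 k (v : tup k.+1 -> int) :
  inL v -> (forall g x, d0 v g x = 0) -> forall x, v x = 0.
Proof.
move=> [va v0] vI x; case: k => [|k] in v va v0 vI x *; last first.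
  have := vI (tr ord0 (lift ord0 ord0) x) x.
  by rewrite /d0 (alt_tperm _ va) //; lia.
have vc a : v (tcons a (ttail x)) = v x.
  have := vI (tperm (x ord0) a) x; rewrite /d0.
  suff -> : mv (tperm (x ord0) a) x = tcons a (ttail x) by lia.
  by apply: eq_tup1; rewrite tcons0 ffunE tpermL.
have := v0 (ttail x); rewrite /bd; under eq_bigr do rewrite vc.
rewrite sumr_const -mulr_natl => /eqP; rewrite mulf_eq0 => /orP[|/eqP //].
rewrite natz eqz_nat -leqn0 leqNgt => /negP[].
by apply/card_gt0P; exists (x ord0).
Qed.

Lemma inL_cone k o (w : tup k.+1 -> int) :
  inL w -> alt (cone o w) /\ forall x, bd (cone o w) x = w x.
Proof.
by case=> wa w0; split=> [|x]; [apply: cone_alt | rewrite bd_cone].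
Qed.

Lemma altB k (u v : tup k -> int) : alt u -> alt v -> alt (fun x => u x - v x).
Proof. by move=> ua va i j x ij; rewrite ua // va //; ring. Qed.

Lemma altZ k c (u : tup k -> int) : alt u -> alt (fun x => c * u x).
Proof. by move=> ua i j x ij; rewrite ua // mulrN. Qed.

Lemma alt_d0 k (v : tup k -> int) g : alt v -> alt (d0 v g).
Proof. by move=> va i j x ij; rewrite /d0 mv_sw !va //; ring. Qed.

Lemma alt_d1 k (u : {perm T} -> tup k -> int) g h :
  (forall g, alt (u g)) -> alt (d1 u g h).
Proof. by move=> ua i j x ij; rewrite /d1 mv_sw !ua //; ring. Qed.

(** A cocycle with values in the cycles of degree [k + 1] is shifted to a
    crossed homomorphism into the cycles of degree [k]. *)
Lemma bd_lift_cocycle1 k (f : {perm T} -> {perm T} -> tup k.+1 -> int) c u :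
    (forall g h, inL (f g h)) -> (forall g h x, c * f g h x = d1 u g h x) ->
  forall g h x, d1 (fun g => bd (u g)) g h x = 0.
Proof.
move=> fL uE g h x; rewrite -bd_d1 -(eq_bd _ (uE g h)) bdZ.
by rewrite (fL g h).2 mulr0.
Qed.

(** Two shifts lead from degree two to the invariants of degree zero. As these
    vanish, the second primitive [v] is a cycle, hence a boundary, and its
    primitive corrects the first one. *)
Lemma hook3_cocycle2 k (f : {perm T} -> {perm T} -> tup k.+3 -> int) :
    T -> (forall g h, inL (f g h)) -> (forall g h l x, d2 f g h l x = 0) ->
  exists2 u, forall g, inL (u g) &
    forall g h x, (signc k.+2 * signc k.+3)%:Z * f g h x = d1 u g h x.
Proof.
move=> o fL f0.
have [h ha hE] := alt_cocycle2 (fun g h => (fL g h).1) f0.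
have [v va vE] :=
  alt_cocycle1 (fun g => bd_alt (ha g)) (bd_lift_cocycle1 fL hE).
have vI g x : d0 (bd v) g x = 0.
  by rewrite -bd_d0 -(eq_bd _ (vE g)) bdZ bd_bd ?mulr0.
have v0 : forall x, bd v x = 0.
  apply: inv_inL_eq0 vI; split=> [|x]; [exact: bd_alt | exact: bd_bd].
have [wa wE] := inL_cone o (conj va v0).
exists (fun g x => (signc k.+2)%:Z * h g x - d0 (cone o v) g x) => [g|g l x].
  split=> [|x]; first by apply: altB; [apply: altZ | apply: alt_d0].
  by rewrite bdB bdZ vE bd_d0 /d0 !wE subrr.
rewrite PoszM -mulrA hE; have := d1_d0 (cone o v) g l x; rewrite /d1.
by lia.
Qed.

(** The connecting map from the cohomology of the second exterior power to the
    integers modulo #|T|: lift a cocycle to the alternating functions, contract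
    it, write the result as the coboundary of a function on [T], and sum. The
    coefficients are the powers of 2 that these steps cost. *)
Definition hook2_class (f : {perm T} -> {perm T} -> tup 2 -> int) (m : int) :=
  exists (u : {perm T} -> tup 2 -> int) (v : tup 1 -> int),
  [/\ forall g, alt (u g), forall g h x, 4 * f g h x = d1 u g h x,
      forall g x, 2 * bd (u g) x = d0 v g x & forall x, bd v x = m].

Lemma eq_tup0 (x y : tup 0) : x = y.
Proof. by apply/ffunP => -[]. Qed.

Lemma hook2_class_exists f :
    T -> (forall g h, inL (f g h)) -> (forall g h l x, d2 f g h l x = 0) ->
  exists m, hook2_class f m.
Proof.
move=> o fL f0; have [h ha hE] := alt_cocycle2 (fun g h => (fL g h).1) f0.
have [|v vE] := @crossed_mod 0 (fun g => bd (h g)).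
  by move=> g l x; rewrite (bd_lift_cocycle1 fL hE).
exists (bd v (ttail [ffun=> o])), h, v; split=> // [g x|x].
  by have := vE g x; rewrite dvd0z subr_eq0 => /eqP.
by congr bd; apply: eq_tup0.
Qed.

Lemma hook2_class_ext f f' m :
  (forall g h, f g h =1 f' g h) -> hook2_class f m -> hook2_class f' m.
Proof.
move=> ff' [u [v [ua uE vE vm]]]; exists u, v; split=> // g h x.
by rewrite -ff'.
Qed.

Lemma hook2_classB f f' m m' : hook2_class f m -> hook2_class f' m' ->
  hook2_class (fun g h x => f g h x - f' g h x) (m - m').
Proof.
move=> [h [v [ha hE vE vm]]] [h' [v' [ha' hE' vE' vm']]].
exists (fun g x => h g x - h' g x), (fun x => v x - v' x); split.
- by move=> g; apply: altB.
- by move=> g l x; rewrite mulrBr hE hE' /d1; ring.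
- by move=> g x; rewrite bdB mulrBr vE vE' /d0; ring.
- by move=> x; rewrite bdB vm vm'.
Qed.

(** The class of a coboundary is a multiple of #|T|, up to a power of 2: after
    correction by a boundary, [v] becomes a constant function. *)
Lemma hook2_class_coboundary f u m :
    (forall g, inL (u g)) -> (forall g h x, f g h x = d1 u g h x) ->
  hook2_class f m -> (#|T| %| 4 * m)%Z.
Proof.
move=> uL uE [h [v [ha hE vE vm]]].
have [|g l x|w wa wE] := @alt_cocycle1 _ (fun g x => h g x - 4 * u g x).
- by move=> g; apply: altB => //; apply: altZ; case: (uL g).
- by have := hE g l x; rewrite uE /d1; lia.
have vI g x : d0 (fun x => 4 * v x - 2 * bd w x) g x = 0.
  have : bd (fun y => 4 * (h g y - 4 * u g y)) x = d0 (bd w) g x.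
    by rewrite -bd_d0; apply: eq_bd => y; rewrite -wE.
  by rewrite bdZ bdB bdZ (uL g).2; have := vE g x; rewrite /d0; lia.
have [o _|T0] := pickP T; last first.
  by rewrite -(vm (ffun0 (card_ord 0))) /bd big_pred0.
pose x0 : tup 1 := [ffun=> o]; pose c := 4 * v x0 - 2 * bd w x0.
have vc a : 4 * v (tcons a (ttail x0)) - 2 * bd w (tcons a (ttail x0)) = c.
  have := vI (tperm (x0 ord0) a) x0; rewrite /d0 -/c.
  suff -> : mv (tperm (x0 ord0) a) x0 = tcons a (ttail x0) by lia.
  by apply: eq_tup1; rewrite tcons0 ffunE tpermL.
have : bd (fun x => 4 * v x - 2 * bd w x) (ttail x0) = #|T|%:Z * c.
  rewrite /bd; under eq_bigr do rewrite vc.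
  by rewrite sumr_const -mulr_natl natz.
by rewrite bdB !bdZ vm bd_bd // mulr0 subr0 => ->; apply: dvdz_mulr.
Qed.

(** If [q * m] is a multiple of #|T|, a constant can be subtracted from [q * v]
    to make it a cycle, hence a boundary. *)
Lemma hook2_class_kill f m (q : int) :
    T -> hook2_class f m -> (#|T| %| q * m)%Z ->
  exists2 u, forall g, inL (u g)
    & forall g h x, 8 * q * f g h x = d1 u g h x.
Proof.
move=> o [h [v [ha hE vE vm]]] /dvdzP[r qm].
have v'L : inL (fun x : tup 1 => q * v x - r).
  split=> [|x]; first exact: alt1.
  by rewrite bdB bdZ vm qm /bd sumr_const -mulr_natl natz; ring.
have [wa wE] := inL_cone o v'L; set w := cone o _ in wa wE.
exists (fun g x => 2 * q * h g x - d0 w g x) => [g|g l x].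
  split=> [|x]; first by apply: altB; [apply: altZ | apply: alt_d0].
  rewrite bdB bdZ bd_d0 /d0 !wE (mulrC 2) -mulrA vE /d0; lia.
have -> : 8 * q * f g l x = 2 * q * (4 * f g l x) by ring.
by rewrite hE -[LHS]subr0 -(d1_d0 w g l x) /d1; ring.
Qed.

(** The cocycle obtained from the indicator function of a point, whose sum is 1;
    the class is 8 and not 1 because of the coefficients 4 and 2 of
    [hook2_class]. *)
Lemma hook2_class_8 : T ->
  exists f, [/\ forall g h, inL (f g h), forall g h l x, d2 f g h l x = 0
               & hook2_class f 8].
Proof.
move=> o; pose v (x : tup 1) : int := (x ord0 == o)%:R.
have v1 x : bd v x = 1.
  rewrite /bd (bigD1 o) //= big1 => [|a /negPf ao]; rewrite /v tcons0 ?eqxx //.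
  by rewrite ao.
have vL g : inL (d0 v g).
  by split=> [|x]; [apply: alt1 | rewrite bd_d0 /d0 !v1].
pose h g := cone o (d0 v g).
have ha g : alt (h g) by case: (inL_cone o (vL g)).
have hE g x : bd (h g) x = d0 v g x by case: (inL_cone o (vL g)) => _; apply.
exists (d1 h); split=> [g l||].
- split=> [|x]; first exact: alt_d1.
  by rewrite bd_d1 /d1 !hE; apply: d1_d0.
- by move=> g l k x; rewrite d2_d1.
exists (fun g x => 4 * h g x), (fun x => 8 * v x); split=> [g|g l x|g x|x].
- exact: altZ.
- by rewrite /d1; ring.
- by rewrite bdZ hE /d0; ring.
- by rewrite bdZ v1.
Qed.

End Alternating.

(** * The second cohomology group *)

Section H2Theory.

Variables (G : finGroupType) (M : zmodType) (a : gmodule G M).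

Definition H2_class (f : cocycle2 a) : H2 a :=
  \pi_(Quotient.quot (is_coboundary2 (a := a))) f.

Lemma H2_classB f f' : H2_class (f - f') = H2_class f - H2_class f'.
Proof. by rewrite /H2_class raddfB. Qed.

HB.instance Definition _ :=
  GRing.isZmodMorphism.Build (cocycle2 a) (H2 a) H2_class H2_classB.

Lemma H2_class_surj x : exists f, H2_class f = x.
Proof.
exists (generic_quotient.repr x).
by rewrite /H2_class generic_quotient.reprK.
Qed.

Lemma H2_class_eq0 f :
  H2_class f = 0 <-> exists u : G -> M,
    forall g h, val f (g, h) = a g (u h) - u (g * h)%g + u g.
Proof.
have -> : (H2_class f = 0) <-> (f \in is_coboundary2 (a := a)).
  rewrite -[f in f \in _]subr0 Quotient.idealrBE -(raddf0 H2_class).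
  by split=> [/eqP|/eqP].
rewrite inE; split=> [/asboolP[u fu]|[u fu]].
  by exists u => g h; rewrite fu ffunE.
apply/asboolP; exists (finfun u); apply/ffunP => -[g h].
by rewrite fu !ffunE.
Qed.

Lemma cocycle2P (f : cocycle2 a) g h k :
  a g (f (h, k)) - f (g * h, k)%g + f (g, h * k)%g - f (g, h) = 0.
Proof. by have /eqP/ffunP/(_ (g, h, k)) := valP f; rewrite !ffunE. Qed.

Lemma cocycle2_of (f : G -> G -> M) :
    (forall g h k, a g (f h k) - f (g * h)%g k + f g (h * k)%g - f g h = 0) ->
  exists f' : cocycle2 a, forall g h, f' (g, h) = f g h.
Proof.
move=> f0; pose f1 : {ffun G * G -> M} := [ffun x => f x.1 x.2].
have f1P : f1 \in is_cocycle2 a.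
  by rewrite inE; apply/eqP/ffunP => -[[g h] k]; rewrite !ffunE /= f0.
by exists (Cocycle2 f1P) => g h; rewrite /= ffunE.
Qed.

End H2Theory.

(** By Cauchy's theorem, a finite group whose order is divisible by [p] has an
    element of order [p]. *)
Lemma not_dvd_order p (H : zmodType) c :
  prime p -> ~~ (p %| c)%N -> (forall x : H, x *+ c = 0) -> ~ dvd_order p H.
Proof.
move=> p_pr pc Hc [A [[f [f' fK f'K]] pA]].
have [|x _ ox] := @Cauchy _ p [set: A]%G p_pr; first by rewrite cardsT.
move: pc; rewrite -ox order_dvdn FinRing.zmodXgE -[x]f'K -raddfMn Hc raddf0.
by rewrite eqxx.
Qed.

Lemma finite_zmod_iso (H : zmodType) (F : finType) (i : H -> F) :
  injective i -> exists A : finZmodType, zmod_iso H A.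
Proof.
move=> iI.
pose j (y : F) : option H := if pselect (exists x, i x = y) is left e
  then Some (projT1 (cid e)) else None.
have ijK : pcancel i j.
  move=> x; rewrite /j; case: pselect => [e|[]]; last by exists x.
  by congr Some; apply: iI; case: cid.
pose C : countType := HB.pack (GRing.Zmodule.sort H) (PCanIsCountable ijK).
pose Fi := @PCanIsFinite C F i j ijK.
pose A : finZmodType := HB.pack (GRing.Zmodule.sort H) (PCanIsCountable ijK) Fi.
by exists A, idfun; exists id.
Qed.

Lemma ffunMzE (I : finType) (V : zmodType) (f : {ffun I -> V}) c x :
  (f *~ c) x = f x *~ c.
Proof.
by case: c => k; rewrite -?pmulrn ?NegzE ?mulrNz -?pmulrn ?ffunE ffunMnE.
Qed.

Lemma cocycle2_mulrz (G : finGroupType) (M : zmodType) (a : gmodule G M)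
    (f : cocycle2 a) c x :
  (f *~ c) x = f x *~ c.
Proof.
have -> : cocycle2_val (f *~ c) = cocycle2_val f *~ c by exact: (raddfMz \val).
exact: ffunMzE.
Qed.

Lemma cocycle2_sub (G : finGroupType) (M : zmodType) (a : gmodule G M)
    (f f' : cocycle2 a) x :
  (f - f') x = f x - f' x.
Proof.
have -> : cocycle2_val (f - f') = cocycle2_val f - cocycle2_val f'.
  exact: (raddfB \val).
by rewrite !ffunE.
Qed.

(** * Tableaux and the Specht modules of hooks *)

Section Tableaux.

Variable la : seq nat.
Local Notation n := (sumn la).
Implicit Types (t : tableau la) (c : cell la) (g : 'S_n).

Lemma card_cell : #|cell la| = n.
Proof.
rewrite card_tagged -[in RHS](mkseq_nth 0%N la) /mkseq -val_enum_ord -map_comp.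
by congr sumn; apply: eq_map => i; rewrite /= card_ord.
Qed.

Lemma fill_inj t : injective (fill t).
Proof. exact: (injectiveP _ (valP t)). Qed.

Lemma fill_surj t b : exists c, fill t c = b.
Proof.
have := inj_card_onto (@fill_inj t); rewrite card_cell card_ord leqnn.
by move=> /(_ isT b) /codomP[c ->]; exists c.
Qed.

Lemma fill_move g t c : fill (move_tableau g t) c = g (fill t c).
Proof. by rewrite /fill /= ffunE. Qed.

Lemma tableau_rowE t i c : (fill t c \in tableau_row t i) = (cell_row c == i).
Proof.
by apply/imsetP/eqP => [[c' ci /fill_inj ->]|ci]; [rewrite inE in ci; apply/eqP|
   exists c; rewrite // inE ci].
Qed.

Lemma tableau_colE t i c : (fill t c \in tableau_col t i) = (cell_col c == i).
Proof.
by apply/imsetP/eqP => [[c' ci /fill_inj ->]|ci]; [rewrite inE in ci; apply/eqP|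
   exists c; rewrite // inE ci].
Qed.

Lemma cell_eqP c c' : cell_row c = cell_row c' -> cell_col c = cell_col c' ->
  c = c'.
Proof.
case: c c' => [i j] [i' j']; rewrite /cell_row /cell_col /= => ii'.
move/val_inj: ii' => ii'; case: _ / ii' j' => j' /= jj'.
by congr (Tagged _ _); apply: val_inj.
Qed.

Lemma tableau_exists : exists t : tableau la, true.
Proof.
have e : #|cell la| = n := card_cell.
pose F : {ffun cell la -> 'I_n} := [ffun c => cast_ord e (enum_rank c)].
have FI : injectiveb F.
  by apply/injectiveP => c c'; rewrite !ffunE => /cast_ord_inj/enum_rank_inj.
by exists (Sub F FI).
Qed.

Lemma tabloidP (T : tabloid la) : exists t, T = tabloid_of t.
Proof.
have /existsP[t /eqP Tt] := valP T.
by exists t; apply: val_inj.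
Qed.

Lemma move_tabloid_inj g : injective (move_tabloid g).
Proof.
move=> T U /(congr1 val)/ffunP TU; apply: val_inj; apply/ffunP => i.
by have := TU i; rewrite !ffunE => /imset_inj; apply; apply: perm_inj.
Qed.

Definition coef (T : tabloid la) (v : perm_module la) : int := v T.

Fact coef_is_additive T : zmod_morphism (coef T).
Proof. by move=> u v; rewrite /coef !ffunE. Qed.

HB.instance Definition _ T :=
  GRing.isZmodMorphism.Build (perm_module la) int (coef T) (coef_is_additive T).

Lemma polytabloidE t T : polytabloid t T =
  \sum_(g in col_stab t) (T == tabloid_of (move_tableau g t))%:R *~ (-1) ^+ g.
Proof.
rewrite -[LHS]/(coef T _) raddf_sum; apply: eq_bigr => g _.
by rewrite raddfMz /= /coef ffunE.
Qed.

Lemma specht_ind (P : perm_module la -> Prop) :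
    P 0 -> (forall u v, P u -> P v -> P (u - v)) ->
    (forall t, P (polytabloid t)) ->
  forall v : specht la, P (val v).
Proof.
move=> P0 PB Pt v; have PN u : P u -> P (- u).
  by rewrite -sub0r; apply: PB.
have PD u w : P u -> P w -> P (u + w).
  by move=> Pu Pw; rewrite -[w]opprK; apply: PB => //; apply: PN.
have /asboolP[c ->] := valP v; apply: big_ind => // t _.
have Pn k : P (polytabloid t *+ k).
  by elim: k => // k IHk; rewrite mulrS; apply: PD.
by case: (c t) => k; [apply: Pn | apply/PN/Pn].
Qed.

End Tableaux.

Lemma swK (T : finType) k (i j : 'I_k) : involutive (@sw T k i j).
Proof. by move=> x; apply/ffunP => l; rewrite !ffunE tpermK. Qed.

(** High transitivity of the symmetric group, adjusting one entry at a time. *)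
Lemma tuple_trans (T : finType) k (x y : tup T k) :
  injectiveb x -> injectiveb y -> exists g, mv g x = y.
Proof.
elim: k x y => [|k IHk] x y xI yI; first by exists 1%g; apply: eq_tup0.
have tailI (z : tup T k.+1) : injectiveb z -> injectiveb (ttail z).
  move/injectiveP => zI; apply/injectiveP => i j; rewrite !ffunE => /zI.
  exact: lift_inj.
have [g gE] := IHk _ _ (tailI _ xI) (tailI _ yI).
exists (g * tperm (g (x ord0)) (y ord0))%g; apply/ffunP => i.
rewrite ffunE permM; case: (unliftP ord0 i) => [j|] ->; last exact: tpermL.
have /ffunP/(_ j) := gE; rewrite !ffunE => ->.
rewrite tpermD //; last by rewrite (inj_eq (injectiveP _ yI)).
have /ffunP/(_ j) := gE; rewrite !ffunE => <-.
by rewrite (inj_eq perm_inj) (inj_eq (injectiveP _ xI)).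
Qed.

Section Hook.

Variables (m : nat) (s : seq nat).
Hypotheses (m_gt0 : (0 < m)%N) (s1 : all (pred1 1%N) s).

Local Notation la := (m :: 1%N :: s).
Local Notation n := (sumn la).
Local Notation k := (size s).
Implicit Types (t : tableau la) (g : 'S_n).

Lemma hook_row_gt0 (i : 'I_(size la)) : (0 < nth 0%N la i)%N.
Proof.
case: i => -[//|[//|i]] /= ik; rewrite !ltnS in ik.
by have /allP/(_ _ (mem_nth 0%N ik))/eqP -> := s1.
Qed.

Lemma hook_row1 (i : 'I_(size la)) : (0 < i)%N -> nth 0%N la i = 1%N.
Proof.
case: i => -[//|[//|i]] /= ik _; rewrite !ltnS in ik.
by have /allP/(_ _ (mem_nth 0%N ik))/eqP -> := s1.
Qed.

Definition ccol (i : 'I_(size la)) : cell la :=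
  Tagged (fun i : 'I_(size la) => 'I_(nth 0%N la i)) (Ordinal (hook_row_gt0 i)).

Definition fcol t : tup 'I_n k.+2 := [ffun i => fill t (ccol i)].

Lemma cell_legP (c : cell la) (i : 'I_(size la)) :
  (0 < i)%N -> cell_row c = i -> c = ccol i.
Proof.
move=> i0 ci; apply: cell_eqP => //; apply/eqP.
have : (cell_col c < nth 0%N la (cell_row c))%N := ltn_ord _.
by rewrite ci hook_row1 // ltnS leqn0.
Qed.

Lemma cell_colP (c : cell la) : cell_col c = 0%N -> c = ccol (tag c).
Proof. by move=> c0; apply: cell_eqP. Qed.

Lemma fcol_inj t : injectiveb (fcol t).
Proof.
apply/injectiveP => i j; rewrite !ffunE => /fill_inj /(congr1 (@cell_row _)).
exact: val_inj.
Qed.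

Lemma row_leg t (i : 'I_k.+1) :
  rows_of t (lift ord0 i) = [set ttail (fcol t) i].
Proof.
apply/setP => b; have [c <-] := fill_surj t b.
rewrite ffunE tableau_rowE inE !ffunE (inj_eq (@fill_inj _ t)).
by apply/eqP/eqP => [ci|-> //]; exact: (cell_legP _ ci).
Qed.

Lemma fcol_move g t : fcol (move_tableau g t) = mv g (fcol t).
Proof. by apply/ffunP => i; rewrite !ffunE fill_move. Qed.

Lemma fcol_exists (y : tup 'I_n k.+2) :
  injectiveb y -> exists t, fcol t = y.
Proof.
move=> yI; have [t _] := tableau_exists la.
have [g gE] := tuple_trans (fcol_inj t) yI.
by exists (move_tableau g t); rewrite fcol_move.
Qed.

Lemma tableau_col0 t : tableau_col t 0 = [set x in codom (fcol t)].
Proof.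
apply/setP => b; have [c <-] := fill_surj t b.
rewrite tableau_colE inE; apply/eqP/codomP => [/cell_colP cE|[i]].
  by exists (tag c); rewrite ffunE -cE.
by rewrite ffunE => /fill_inj ->.
Qed.

Lemma col_stab_hook t : col_stab t = [set g | perm_on (tableau_col t 0) g].
Proof.
apply/setP => g; rewrite !inE.
apply/forallP/idP => [gc|gA j].
  apply/subsetP => b; rewrite inE; apply: contraR.
  have [c <-] := fill_surj t b; rewrite tableau_colE => c0.
  have row0 (c' : cell la) : cell_col c' != 0%N -> cell_row c' = 0%N.
    move=> c'0; apply/eqP; rewrite -leqn0 leqNgt; apply: contra c'0 => c'0.
    by rewrite (@cell_legP c' (tag c') c'0 erefl).
  have cn : (cell_col c < n)%N.
    have := ltn_ord (tagged c); rewrite -/(cell_col c).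
    by rewrite -/(cell_row c) row0 //= => /leq_trans; apply; rewrite leq_addr.
  have /eqP/setP/(_ (g (fill t c))) := gc (Ordinal cn).
  rewrite mem_imset ?tableau_colE ?eqxx //; last exact: perm_inj.
  have [c' c'E] := fill_surj t (g (fill t c)).
  rewrite -c'E tableau_colE => /esym/eqP c'c; apply/eqP; congr fill.
  by apply: cell_eqP => //; rewrite !row0 // c'c.
have [j0|j0] := eqVneq (val j) 0%N; first by rewrite j0 im_perm_on.
rewrite -[X in _ == X]imset_id; apply/eqP/eq_in_imset => b.
have [c <-] := fill_surj t b; rewrite tableau_colE => /eqP cj.
by rewrite (out_perm gA) // tableau_colE cj.
Qed.

Definition tab_match (T : tabloid la) (x : tup 'I_n k.+1) : bool :=
  [forall i, val T (lift ord0 i) == [set x i]].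

Lemma tab_match_of t x : tab_match (tabloid_of t) x = (x == ttail (fcol t)).
Proof.
apply/forallP/eqP => [tx|-> i]; last by rewrite /= row_leg.
apply/ffunP => i; have /eqP := tx i; rewrite row_leg => /set1_inj.
by rewrite ffunE.
Qed.

Lemma tab_match_inj T U x : tab_match T x -> tab_match U x -> T = U.
Proof.
have [t ->] := tabloidP T; have [u ->] := tabloidP U.
rewrite !tab_match_of => /eqP tx /eqP ux; rewrite tx in ux.
have row0 (v : tableau la) b :
    (b \in rows_of v ord0) = (b \notin codom (ttail (fcol v))).
  have [c <-] := fill_surj v b; rewrite ffunE tableau_rowE.
  apply/eqP/idP => [c0|].
    apply/codomP => -[i]; rewrite !ffunE => /fill_inj ci.
    by rewrite ci in c0.
  apply: contraNeq => c0; have c_gt0 : (0 < tag c)%N by rewrite lt0n.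
  apply/codomP; have : tag c != ord0 by [].
  rewrite eq_sym => /unlift_some[i ti _].
  by exists i; rewrite !ffunE -ti -(@cell_legP c (tag c) c_gt0 erefl).
apply: val_inj; apply/ffunP => i; rewrite /=; case: (unliftP ord0 i) => [j|] ->.
  by rewrite !row_leg ux.
by apply/setP => b; rewrite !row0 ux.
Qed.

Lemma tab_match_move g T x :
  tab_match (move_tabloid g T) (mv g x) = tab_match T x.
Proof.
apply: eq_forallb => i; rewrite !ffunE -imset_set1.
exact: (inj_eq (imset_inj perm_inj)).
Qed.

(** A tabloid of hook shape is determined by its rows of length one, so that
    functions on tabloids become functions on tuples. *)
Definition leg_fun (v : perm_module la) (x : tup 'I_n k.+1) : int :=
  \sum_(T | tab_match T x) v T.

Lemma leg_funB u v x : leg_fun (u - v) x = leg_fun u x - leg_fun v x.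
Proof. by rewrite /leg_fun -sumrB; apply: eq_bigr => T _; rewrite !ffunE. Qed.

Lemma leg_fun_of v t : leg_fun v (ttail (fcol t)) = v (tabloid_of t).
Proof.
rewrite /leg_fun (big_pred1 (tabloid_of t)) // => T.
have tt : tab_match (tabloid_of t) (ttail (fcol t)) by rewrite tab_match_of.
by apply/idP/eqP => [/tab_match_inj|->]; [apply|].
Qed.

Lemma leg_fun_inj u v : leg_fun u =1 leg_fun v -> u = v.
Proof.
move=> uv; apply/ffunP => T; have [t ->] := tabloidP T.
by rewrite -!leg_fun_of.
Qed.

Lemma leg_fun_act g v x : leg_fun (perm_act g v) x = leg_fun v (mv g x).
Proof.
rewrite [RHS]/leg_fun (reindex_inj (@move_tabloid_inj _ g)) /=.
apply: eq_big => [T|T _]; first by rewrite tab_match_move.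
by rewrite ffunE.
Qed.

(** The alternating basis function attached to [y]. *)
Definition alt_delta (y z : tup 'I_n k.+2) : int :=
  \sum_(g | perm_on [set x in codom y] g) (mv g y == z)%:R *~ (-1) ^+ g.

Lemma alt_delta_alt (y : tup 'I_n k.+2) : injectiveb y -> alt (alt_delta y).
Proof.
move=> yI i j z ij; rewrite /alt_delta.
have yA l : y l \in [set x in codom y] by rewrite inE codom_f.
have tA : perm_on [set x in codom y] (tperm (y i) (y j)).
  exact: perm_on_tperm.
rewrite (reindex_inj (mulgI (tperm (y i) (y j)))) -sumrN; apply: eq_big => g.
  by apply/idP/idP => gA; [rewrite -[g](mulKg (tperm (y i) (y j))) tpermV|];
    apply: perm_onM.
move=> gA; rewrite mvM mv_tperm // mv_sw (can_eq (swK i j)).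
by rewrite odd_mul_tperm (inj_eq (injectiveP _ yI)) ij addTb signrN mulrNz.
Qed.

Lemma sum_indicator (I : finType) (P : pred I) (i0 : I) :
  \sum_(i | P i) (i == i0)%:R = (P i0)%:R :> int.
Proof.
rewrite big_mkcond (bigD1 i0) //= eqxx big1 => [|i /negPf ->]; last first.
  by case: ifP.
by rewrite addr0; case: ifP.
Qed.

(** The column stabilizer is the symmetric group of the first column, and a
    tabloid forgets the corner entry, over which the contraction sums. *)
Lemma leg_fun_polytabloid t x :
  leg_fun (polytabloid t) x = bd (alt_delta (fcol t)) x.
Proof.
rewrite /leg_fun; under eq_bigr do rewrite polytabloidE.
rewrite exchange_big /bd /alt_delta [RHS]exchange_big /=.
apply: eq_big => [g|g gc].
  by rewrite col_stab_hook inE tableau_col0.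
rewrite -!mulrz_suml sum_indicator tab_match_of fcol_move; congr (_ *~ _).
rewrite -[LHS](sum_indicator (fun=> x == ttail (mv g (fcol t)))
  (mv g (fcol t) ord0)) big_mkcond; apply: eq_bigr => a _ /=.
have -> : (mv g (fcol t) == tcons a x) =
  (x == ttail (mv g (fcol t))) && (a == mv g (fcol t) ord0).
  apply/eqP/andP => [->|[/eqP -> /eqP ->]]; last by rewrite tcons_tail.
  by rewrite ttail_cons tcons0.
by case: (x == _).
Qed.

Lemma polytabloid_in t : polytabloid t \in @in_specht la.
Proof.
rewrite inE; apply/asboolP; exists [ffun u => (u == t)%:R].
rewrite (bigD1 t) //= ffunE eqxx big1 ?addr0 // => u /negPf ut.
by rewrite ffunE ut.
Qed.

Lemma leg_funDz u v c x :
  leg_fun (u + v *~ c) x = leg_fun u x + c * leg_fun v x.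
Proof.
rewrite /leg_fun mulr_sumr -big_split; apply: eq_bigr => T _ /=.
by rewrite -[LHS]/(coef T _) raddfD raddfMz /= -mulrzl intz.
Qed.

Lemma leg_fun_inL (v : specht la) : inL (leg_fun (val v)).
Proof.
apply: (@specht_ind _ (fun u => inL (leg_fun u))) => [|u w [ua u0] [wa w0]|t].
- split=> [i j x _|x].
    by rewrite /leg_fun !big1 // => T _; rewrite ffunE.
  by rewrite /bd big1 // => b _; rewrite /leg_fun big1 // => T _; rewrite ffunE.
- split=> [i j x ij|x]; first by rewrite !leg_funB ua // wa //; ring.
  by rewrite (eq_bd _ (leg_funB u w)) bdB u0 w0.
have da := alt_delta_alt (fcol_inj t).
split=> [i j x ij|x]; first by rewrite !leg_fun_polytabloid (bd_alt da).
by rewrite (eq_bd _ (leg_fun_polytabloid t)) bd_bd.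
Qed.

Lemma alt_perm (w : tup 'I_n k.+2 -> int) (y : tup 'I_n k.+2) g :
    alt w -> injectiveb y -> perm_on [set x in codom y] g ->
  w (mv g y) = w y *~ (-1) ^+ g.
Proof.
move=> wa yI; move: g; apply: perm_on_ind => [|a b g aA bA ab gA IH].
  by rewrite mv1 odd_perm1.
move: aA bA ab; rewrite !inE => /codomP[i ->] /codomP[j ->] ij.
rewrite mvM mv_tperm // mv_sw wa ?IH; last by apply: contra ij => /eqP ->.
by rewrite odd_mul_tperm ij addTb signrN mulrNz.
Qed.

Lemma alt_delta_id (y : tup 'I_n k.+2) : alt_delta y y = 1.
Proof.
rewrite /alt_delta (bigD1 1%g) ?perm_on1 //= mv1 eqxx odd_perm1.
rewrite big1 => [|g /andP[gA g1]]; first by rewrite addr0.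
case: eqP => [gy|_]; last by rewrite mul0rz.
case/eqP: g1.
apply/permP => b; rewrite perm1; have [|bA] := boolP (b \in [set x in codom y]).
  by rewrite inE => /codomP[i ->]; have /ffunP/(_ i) := gy; rewrite ffunE.
exact: out_perm gA bA.
Qed.

(** Polytabloids exhaust the boundaries: the basis functions are subtracted one
    by one, which reduces the support. *)
Lemma leg_fun_bd (w : tup 'I_n k.+2 -> int) :
  alt w -> exists v : specht la, leg_fun (val v) =1 bd w.
Proof.
have [N] := ubnP #|[set y | w y != 0]|; elim: N w => // N IHN w le_wN wa.
have [w0|[y]] := set_0Vmem [set y | w y != 0].
  exists 0 => x; rewrite /leg_fun big1 => [|T _]; last by rewrite ffunE.
  rewrite /bd big1 // => a _; apply/eqP; apply: contraT => wx.
  by move/setP/(_ (tcons a x)): w0; rewrite !inE wx.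
rewrite inE => wy; have yI : injectiveb y.
  by apply: contraNT wy => /(alt_ninj wa) ->.
have [t ty] := fcol_exists yI.
pose w' z := w z - w y * alt_delta y z.
have [||v vE] := IHN w'.
- rewrite ltnS in le_wN; apply: leq_trans le_wN; apply: proper_card.
  apply/properP; split; last first.
    by exists y; rewrite !inE // /w' alt_delta_id mulr1 subrr eqxx.
  apply/subsetP => z; rewrite !inE; apply: contra => /eqP wz.
  rewrite /w' wz /alt_delta big1 ?mulr0 ?subrr // => g gA.
  case: eqP => [gz|_]; last by rewrite mul0rz.
  by case/eqP: wy; have := alt_perm wa yI gA; rewrite gz wz;
     case: (odd_perm g); rewrite ?expr0 ?expr1; lia.
- by apply: altB => //; apply/altZ/alt_delta_alt.
exists (Specht (rpredD (valP v) (rpredMz (w y) (polytabloid_in t)))) => x.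
rewrite leg_funDz vE /w' bdB bdZ -ty -leg_fun_polytabloid; ring.
Qed.

Lemma leg_fun_surj (w : tup 'I_n k.+1 -> int) :
  inL w -> exists v : specht la, leg_fun (val v) =1 w.
Proof.
move=> wL; have n_gt0 : (0 < n)%N by rewrite /= addnC.
have [wa wE] := inL_cone (Ordinal n_gt0) wL.
by have [v vE] := leg_fun_bd wa; exists v => x; rewrite vE wE.
Qed.

Local Notation Mod := (specht_module la).

Definition leg (v : specht la) : tup 'I_n k.+1 -> int := leg_fun (val v).

Lemma leg_inj u v : leg u =1 leg v -> u = v.
Proof. by move=> uv; apply/val_inj/leg_fun_inj. Qed.

Lemma legB u v x : leg (u - v) x = leg u x - leg v x.
Proof. by rewrite /leg raddfB leg_funB. Qed.

Lemma leg0 x : leg 0 x = 0.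
Proof. by rewrite -(subrr 0) legB subrr. Qed.

Lemma legD u v x : leg (u + v) x = leg u x + leg v x.
Proof.
have -> : u + v = u - (0 - v) by rewrite sub0r opprK.
by rewrite !legB leg0; ring.
Qed.

Lemma legMz u c x : leg (u *~ c) x = c * leg u x.
Proof.
rewrite /leg raddfMz -[_ *~ c]add0r leg_funDz -[0](subrr (val u)) leg_funB.
by rewrite subrr add0r.
Qed.

Lemma leg_act g u x : leg (Mod g u) x = leg u (mv g x).
Proof. exact: leg_fun_act. Qed.

Lemma leg_surj (u : {perm 'I_n} -> tup 'I_n k.+1 -> int) :
    (forall g, inL (u g)) ->
  exists v : 'S_n -> specht la, forall g, leg (v g) =1 u g.
Proof.
move=> uL; have /choice[v vE] g : exists v, leg v =1 u g by apply: leg_fun_surj.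
by exists v.
Qed.

Definition leg_cochain (f : cocycle2 Mod) g h : tup 'I_n k.+1 -> int :=
  leg (f (g, h)).

Lemma leg_cochain_inL f g h : inL (leg_cochain f g h).
Proof. exact: leg_fun_inL. Qed.

Lemma leg_cochainB f f' g h x :
  leg_cochain (f - f') g h x = leg_cochain f g h x - leg_cochain f' g h x.
Proof. by rewrite -legB /leg_cochain cocycle2_sub. Qed.

Lemma leg_cochain_cocycle f g h l x : d2 (leg_cochain f) g h l x = 0.
Proof.
by rewrite -[RHS](leg0 x) -(cocycle2P f g h l) !(legB, legD) leg_act.
Qed.

Lemma leg_cochain_of (F : {perm 'I_n} -> {perm 'I_n} -> tup 'I_n k.+1 -> int) :
    (forall g h, inL (F g h)) -> (forall g h l x, d2 F g h l x = 0) ->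
  exists f : cocycle2 Mod, forall g h, leg_cochain f g h =1 F g h.
Proof.
move=> FL F0; have /choice[f0 f0E] g := leg_surj (FL g).
have [|f fE] := @cocycle2_of _ _ Mod f0; last first.
  by exists f => g h x; rewrite /leg_cochain fE f0E.
move=> g h l; apply: leg_inj => x.
by rewrite !(legB, legD) leg_act !f0E leg0; apply: F0.
Qed.

Lemma leg_class_kill (f : cocycle2 Mod) c :
    (exists2 u, forall g, inL (u g)
       & forall g h x, c * leg_cochain f g h x = d1 u g h x) ->
  H2_class f *~ c = 0.
Proof.
case=> u uL uE; have [u0 u0E] := leg_surj uL.
rewrite -raddfMz; apply/H2_class_eq0; exists u0 => g h.
apply: leg_inj => x.
have -> : \val (f *~ c) (g, h) = f (g, h) *~ c := cocycle2_mulrz f c (g, h).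
by rewrite legMz !(legB, legD) leg_act !u0E; apply: uE.
Qed.

Lemma leg_class_eq0 (f : cocycle2 Mod) :
  H2_class f = 0 -> exists2 u, forall g, inL (u g)
       & forall g h x, leg_cochain f g h x = d1 u g h x.
Proof.
move/H2_class_eq0=> [u uE]; exists (fun g => leg (u g)) => [g|g h x].
  exact: leg_fun_inL.
by rewrite /leg_cochain [f _]uE !(legB, legD) leg_act.
Qed.

Lemma hook_kill c :
    (forall f, (forall g h, inL (f g h)) ->
       (forall g h l x, d2 f g h l x = 0) ->
     exists2 u, forall g, inL (u g)
       & forall g h (x : tup 'I_n k.+1), c * f g h x = d1 u g h x) ->
  forall x : H2_specht la, x *~ c = 0.
Proof.
move=> kill x; have [f <-] := H2_class_surj x.
apply: leg_class_kill.
exact: kill (leg_cochain_inL f) (leg_cochain_cocycle f).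
Qed.

End Hook.

(** * Cohomology of the Specht modules of hooks *)

(** With trivial coefficients, averaging turns a cocycle into a homomorphism
    modulo the order of the group, and homomorphisms are 2-torsion. *)
Lemma trivial_H2 (T : finType) (M : zmodType) (a : gmodule {perm T} M) :
    (forall g x, a g x = x) -> (forall (x : M) c, x *+ c.+1 = 0 -> x = 0) ->
  forall x : H2 a, x *+ 2 = 0.
Proof.
move=> a1 Mtf x; have [f <-] := H2_class_surj x.
have [N NE] : exists N, #|{perm T}| = N.+1.
  by exists #|{perm T}|.-1; rewrite prednK //; apply/card_gt0P; exists 1%g.
pose u g := \sum_k f (g, k).
have uE g h : f (g, h) *+ N.+1 = u h - u (g * h)%g + u g.
  have -> : u g = \sum_k f (g, h * k)%g by apply/reindex_inj/mulgI.
  rewrite /u -NE -sumr_const -sumrB -big_split; apply: eq_bigr => k _.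
  by rewrite -(subr0_eq (cocycle2P f g h k)) a1.
have /choice[w wE] g : exists w, u g *+ 2 = w *+ N.+1.
  apply: (@perm_on_hom_mod _ setT _ (fun y => exists w, y = w *+ N.+1)).
  - by exists 0; rewrite mul0rn.
  - by move=> _ _ [y ->] [z ->]; exists (y - z); rewrite mulrnBl.
  - move=> s t _ _; exists (- f (s, t)); rewrite mulNrn uE !opprD opprK.
    by rewrite (addrC (- u t)) addrAC.
  - by apply/subsetP => y; rewrite inE.
rewrite -raddfMn; apply/H2_class_eq0; exists w => g h.
have -> : \val (f *+ 2) (g, h) = f (g, h) *+ 2.
  by have := cocycle2_mulrz f 2 (g, h).
apply/eqP; rewrite -subr_eq0; apply/eqP/(Mtf _ N).
rewrite mulrnBl -mulrnA mulnC mulrnA uE a1.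
by rewrite !(mulrnDl, mulNrn) !wE subrr.
Qed.

Lemma trivial_specht (m : nat) g (v : specht [:: m]) : specht_act g v = v.
Proof.
apply: val_inj; apply/ffunP => T; rewrite ffunE; congr (val v _).
have rowT (U : tabloid [:: m]) : val U = [ffun=> setT].
  have [t ->] := tabloidP U; apply/ffunP => i; rewrite !ffunE.
  apply/setP => b; have [c <-] := fill_surj t b; rewrite tableau_rowE inE.
  by rewrite /cell_row (ord1 (tag c)) (ord1 i).
by apply: val_inj; rewrite (rowT T) (rowT (move_tabloid g T)).
Qed.

Lemma specht_torsion_free la (v : specht la) c : v *+ c.+1 = 0 -> v = 0.
Proof.
move=> vc; apply: val_inj; apply/ffunP => T; apply/eqP.
have vc0 : val v *+ c.+1 = 0 by rewrite -raddfMn vc.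
have : coef T (val v *+ c.+1) == 0 by rewrite vc0 raddf0.
by rewrite raddfMn /= mulrn_eq0 /coef ffunE.
Qed.

Lemma H2_row (m : nat) : forall x : H2_specht [:: m], x *+ 2 = 0.
Proof.
apply: trivial_H2 => [g v|v c]; first exact: trivial_specht.
exact: specht_torsion_free.
Qed.

Lemma intr_Zp_eq0 e (z : int) : (1 < e)%N -> (z%:~R == 0 :> 'Z_e) = (e %| z)%Z.
Proof.
move=> e1; suff nat_case k : (k%:R == 0 :> 'Z_e) = (e %| k)%N.
  case: z => k; first by rewrite -pmulrn nat_case.
  by rewrite NegzE mulrNz oppr_eq0 -pmulrn nat_case dvdzE abszN.
by rewrite -(inj_eq val_inj) /= val_Zp_nat.
Qed.

Lemma coprime_annih (V : zmodType) (x : V) p c :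
  prime p -> ~~ (p %| c)%N -> x *+ p = 0 -> x *+ c = 0 -> x = 0.
Proof.
move=> p_pr; rewrite -prime_coprime // => pc xp xc.
have [u _] := Bezoutl c (prime_gt0 p_pr).
rewrite (eqP pc) => /dvdnP[w /(congr1 (fun q => x *+ q))].
by rewrite mulrnDr mulr1n (mulnC u) (mulnC w) !mulrnA xp xc !mul0rn addr0.
Qed.

(** An elementary abelian [p]-subgroup meets the kernel of [phi] trivially, so
    it embeds into a cyclic group and is cyclic. *)
Lemma p_rank_le1 p q (A : finZmodType) (phi : A -> 'Z_q) :
    prime p -> (forall x y, phi (x - y) = phi x - phi y) ->
    (forall x, phi x = 0 -> x *+ p = 0 -> x = 0) ->
  ('r_p([set: A])%g <= 1)%N.
Proof.
move=> p_pr phiB phi_inj; have [E] := p_rank_witness p [set: A].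
case/pnElemP=> _ pE <-.
have phi0 : phi 0 = 0 by rewrite -(subrr 0) phiB subrr.
have phiM : {in E &, {morph phi : x y / (x * y)%g}}.
  move=> x y _ _; rewrite !FinRing.zmodMgE -{1}[y]opprK phiB.
  by rewrite -[- y]sub0r phiB phi0 sub0r opprK.
pose f := Morphism phiM.
have fI : ('injm f)%g.
  apply/subsetP => x /morphpreP[xE]; rewrite !inE => /eqP fx.
  by apply/eqP/phi_inj => //; have [_ /(_ x xE)] := abelemP p_pr pE.
rewrite -(abelem_cyclic pE) -(injm_cyclic fI (subxx _)).
apply: cyclicS (subsetT _) _; apply/cyclicP; exists (@Zp1 (Zp_trunc q).+1).
exact: Zp_cycle.
Qed.

Section HookResults.

Variables (m : nat).
Hypotheses (m_gt0 : (0 < m)%N).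

Lemma H2_hook1 (x : H2_specht [:: m; 1%N]) : x *+ 2 = 0.
Proof.
rewrite pmulrn; apply: (@hook_kill m [::] m_gt0 isT 2) => f fL f0.
exact: hook1_cocycle2.
Qed.

Lemma H2_hook3 s (x : H2_specht [:: m, 1, 1, 1 & s]%N) :
  all (pred1 1%N) s -> x *+ (signc (size s).+2 * signc (size s).+3) = 0.
Proof.
move=> s1; rewrite pmulrn.
apply: (@hook_kill m [:: 1, 1 & s]%N m_gt0 s1 (Posz _)) => f fL f0.
have n_gt0 : (0 < sumn [:: m, 1, 1, 1 & s])%N by rewrite /= addnC.
by have [u uL uE] := hook3_cocycle2 (Ordinal n_gt0) fL f0; exists u.
Qed.

Local Notation la := [:: m; 1; 1]%N.
Local Notation n := (sumn la).
Local Notation Mod := (specht_module la).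

Let n_gt0 : (0 < n)%N.
Proof. by rewrite /= addnC. Qed.

Let s1 : all (pred1 1%N) [:: 1%N].
Proof. by []. Qed.

Lemma H2_hook2 (x : H2_specht la) : x *+ (8 * n) = 0.
Proof.
rewrite pmulrn.
apply: (@hook_kill m [:: 1%N] m_gt0 s1 (Posz _)) => f fL f0.
have [c fc] := hook2_class_exists (Ordinal n_gt0) fL f0.
have [|u uL uE] := hook2_class_kill (q := n) (Ordinal n_gt0) fc.
  by rewrite card_ord dvdz_mulr.
by exists u.
Qed.

(** Two cocycles that agree modulo an exponent e of the cohomology group, as
    integer functions, differ by e times a cochain. The latter is again a
    cocycle with values in the Specht module, which is cut out by linear
    equations; so both cocycles have the same class. *)
Lemma H2_hook2_finite : exists A : finZmodType, zmod_iso (H2_specht la) A.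
Proof.
pose e := (8 * n)%N; have e1 : (1 < e)%N by rewrite /e; lia.
have /choice[r rE] := @H2_class_surj _ _ Mod.
pose i x : {ffun 'S_n * 'S_n * tup 'I_n 2 -> 'Z_e} :=
  [ffun y => (leg_cochain (r x) y.1.1 y.1.2 y.2)%:~R].
apply: (@finite_zmod_iso _ _ i) => x y /ffunP xy.
have dvd g h z : (e %| leg_cochain (r x - r y) g h z)%Z.
  have := xy (g, h, z); rewrite !ffunE /= leg_cochainB -intr_Zp_eq0 // rmorphB.
  by move/eqP; rewrite -subr_eq0.
pose F g h z := (leg_cochain (r x - r y) g h z %/ e)%Z.
have FE g h z : e%:Z * F g h z = leg_cochain (r x - r y) g h z.
  by rewrite mulrC divzK.
have e0 : e%:Z != 0 by lia.
have [||f fF] := @leg_cochain_of m [:: 1%N] m_gt0 s1 F.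
- move=> g h; have [lca lc0] := leg_cochain_inL m_gt0 s1 (r x - r y) g h.
  split=> [j l z jl|z]; apply: (mulfI e0); first by rewrite mulrN !FE lca.
  by rewrite -bdZ mulr0 (eq_bd _ (FE g h)) lc0.
- move=> g h l z; apply: (mulfI e0).
  rewrite mulr0 -[RHS](leg_cochain_cocycle (r x - r y) g h l z) /d2 -!FE; ring.
suff xyf : r x - r y = f *~ e.
  apply/eqP; rewrite -subr_eq0 -[x]rE -[y]rE -raddfB xyf raddfMz; apply/eqP.
  exact: H2_hook2.
apply: val_inj; apply/ffunP => -[g h].
have -> : \val (f *~ e) (g, h) = f (g, h) *~ e := cocycle2_mulrz f e (g, h).
apply: (leg_inj m_gt0 s1) => z.
by rewrite legMz; have := fF g h z; rewrite /leg_cochain => ->; rewrite FE.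
Qed.

(** The class of the connecting map, followed by reduction modulo the [p]-part
    of [n]: it embeds the [p]-torsion into a cyclic group. *)
Lemma H2_hook2_embed p : prime p -> (2 < p)%N -> (p %| n)%N ->
  exists phi : H2_specht la -> 'Z_(n`_p),
    [/\ forall x y, phi (x - y) = phi x - phi y,
        forall x, phi x = 0 -> x *+ p = 0 -> x = 0
      & exists x0, phi x0 = 8%:R].
Proof.
move=> p_pr p_gt2 pn; set q := (n`_p)%N.
have q_dvd : (q %| n)%N by apply: dvdn_part.
have q1 : (1 < q)%N by rewrite p_part_gt1 mem_primes p_pr n_gt0.
have pq2 c : (q %| 2 * c)%N = (q %| c)%N.
  rewrite Gauss_dvdr // coprime_sym coprime2n /q.
  rewrite p_part oddX.
  by case: (even_prime p_pr) => [p2|->]; [lia|rewrite orbT].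
pose rel x z := exists f c, [/\ H2_class f = x,
  hook2_class (leg_cochain f : _ -> _ -> tup 'I_n 2 -> int) c
  & z = c%:~R :> 'Z_q].
have relB x y z w : rel x z -> rel y w -> rel (x - y) (z - w).
  move=> [f [c [<- fc ->]]] [f' [c' [<- fc' ->]]].
  exists (f - f'), (c - c'); split; [exact: raddfB| |by rewrite rmorphB].
  apply: hook2_class_ext (hook2_classB fc fc') => g h b.
  by rewrite leg_cochainB.
have rel0 z : rel 0 z -> z = 0.
  move=> [f [c [f0 fc ->]]]; apply/eqP; rewrite intr_Zp_eq0 //.
  have [u uL uE] := leg_class_eq0 m_gt0 s1 f0.
  have := hook2_class_coboundary uL uE fc; rewrite card_ord => nc.
  have : (q %| 2 * (2 * `|c|))%N.
    rewrite mulnA; apply: dvdn_trans q_dvd _.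
    by move: nc; rewrite dvdzE abszM.
  by rewrite !pq2 dvdzE.
have /choice[phi phiP] x : exists z, rel x z.
  have [f <-] := H2_class_surj x.
  have [c fc] := hook2_class_exists (Ordinal n_gt0)
    (leg_cochain_inL m_gt0 s1 f) (leg_cochain_cocycle f).
  by exists c%:~R, f, c.
have phi_uniq x z : rel x z -> phi x = z.
  move=> xz; apply/eqP; rewrite -subr_eq0; apply/eqP/rel0.
  by rewrite -(subrr x); apply: relB.
exists phi; split=> [x y|x x0 xp|].
- exact/phi_uniq/relB.
- have := phiP x; rewrite x0 => -[f [c [fx fc /esym/eqP]]].
  rewrite intr_Zp_eq0 // => qc.
  have nc : (n%:Z %| (n %/ q)%N%:Z * c)%Z.
    by rewrite -[n in X in (X %| _)%Z](divnK q_dvd) PoszM dvdz_mul.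
  have [|u uL uE] := hook2_class_kill (q := (n %/ q)%N) (Ordinal n_gt0) fc.
    by rewrite card_ord.
  apply: (@coprime_annih _ x p (8 * (n %/ q)) p_pr _ xp).
    rewrite Euclid_dvdM // negb_or -[8%N]/(2 ^ 3)%N Euclid_dvdX // andbT.
    rewrite gtnNdvd //= -p'natE // -[n in (n %/ _)%N](partnC p n_gt0) mulKn //.
    by rewrite part_pnat.
  rewrite pmulrn -fx; apply: (leg_class_kill m_gt0 s1).
  by exists u => // g h y; rewrite PoszM -uE.
have [f [fL f0 fc]] := hook2_class_8 (Ordinal n_gt0).
have [F FE] := leg_cochain_of m_gt0 s1 fL f0.
exists (H2_class F); apply: phi_uniq; exists F, 8; split=> //.
by apply: hook2_class_ext fc => g h y; rewrite FE.
Qed.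

Lemma hook2_rank p : prime p -> (2 < p)%N -> (p %| n)%N ->
  dvd_order p (H2_specht la) /\ has_p_rank p (H2_specht la) 1.
Proof.
move=> p_pr p_gt2 pn; have [phi [phiB phi_inj [x0 phix0]]] :=
  H2_hook2_embed p_pr p_gt2 pn.
have [A [f [f' fK f'K]]] := H2_hook2_finite.
have f'B x y : f' (x - y) = f' x - f' y.
  by apply: (can_inj fK); rewrite raddfB !f'K.
have pA : (p %| #|A|)%N.
  (* The image 8 of x0 has the order of the p-part of n, which divides #|A|. *)
  have xA : x0 *+ #|A| = 0.
    apply: (can_inj fK); rewrite raddfMn raddf0 -FinRing.zmodXgE.
    by rewrite -cardsT expg_cardG // inE.
  have phiMn k : phi (x0 *+ k) = phi x0 *+ k.
    have phi0 : phi 0 = 0 by rewrite -(subrr 0) phiB subrr.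
    elim: k => // k IHk; rewrite !mulrS.
    have -> : x0 + x0 *+ k = x0 - (0 - x0 *+ k) by rewrite sub0r opprK.
    by rewrite !phiB phi0 sub0r opprK IHk.
  have := phiMn #|A|; rewrite xA -[0](subrr x0) phiB subrr phix0.
  move/esym/eqP.
  rewrite -mulrnA -[_%:R]/((8 * #|A|)%:Z%:~R) intr_Zp_eq0; last first.
    by rewrite p_part_gt1 mem_primes p_pr n_gt0.
  rewrite dvdzE /= => qA; have : (p %| 8 * #|A|)%N.
    apply: dvdn_trans qA; rewrite p_part dvdn_exp //.
    by rewrite logn_gt0 mem_primes p_pr n_gt0.
  rewrite -[8%N]/(2 ^ 3)%N Euclid_dvdM // Euclid_dvdX // andbT.
  by rewrite gtnNdvd.
have isoA : zmod_iso (H2_specht la) A by exists f; exists f'.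
split; exists A; split=> //; apply/eqP; rewrite eqn_leq; apply/andP; split.
  apply: (@p_rank_le1 _ _ _ (phi \o f')) => // [x y|x fx xp] /=.
    by rewrite f'B phiB.
  apply: (can_inj f'K); have f'0 : f' 0 = 0 by rewrite -(subrr 0) f'B subrr.
  rewrite f'0; apply: phi_inj => //; apply: (can_inj fK).
  by rewrite raddfMn f'K xp raddf0.
by rewrite -cardsT in pA; rewrite p_rank_gt0 mem_primes p_pr cardG_gt0.
Qed.

End HookResults.

(** * Jucys-Murphy elements *)

Section ClassFunction.

Variables (G : finGroupType) (M : zmodType) (a : gmodule G M).

HB.instance Definition _ g :=
  GRing.isZmodMorphism.Build M M (a g) (gactB a g).

Lemma cocycle2E (f : cocycle2 a) g h k :
  a g (f (h, k)) = f (g * h, k)%g - f (g, h * k)%g + f (g, h).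
Proof.
rewrite -(subr0_eq (cocycle2P f g h k)) !addrA.
by rewrite [RHS](ACl ((1*4)*(5*2)*3))%AC /= !subrr !add0r.
Qed.

(** A central element of the group ring acts on cohomology both through the
    coefficients and through the trivial module, that is by its augmentation.
    The homotopy between the two is explicit in the bar complex. *)
Lemma H2_central_kill (w : G -> int) c :
    (forall g h, w (g * h)%g = w (h * g)%g) ->
    (forall v, \sum_s a s v *~ w s = v *~ c) ->
  forall x : H2 a, x *~ (c - \sum_s w s) = 0.
Proof.
move=> wC wc x; have [f <-] := H2_class_surj x; rewrite -raddfMz.
apply/H2_class_eq0.
exists (fun g => \sum_s (f (s, g) - f (g, s)) *~ w s) => g h.
have -> : \val (f *~ (c - \sum_s w s)) (g, h) = f (g, h) *~ (c - \sum_s w s).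
  exact: cocycle2_mulrz f _ (g, h).
rewrite mulrzBr -wc mulrz_sumr -sumrB raddf_sum -sumrB -big_split /=.
have conj (F : G -> M) k :
    \sum_s F (k * s)%g *~ w s = \sum_s F (s * k)%g *~ w s.
  rewrite (reindex_inj (conjg_inj k)); apply: eq_bigr => s _.
  by rewrite conjgE !mulgA mulgV mul1g -wC !mulgA mulgV mul1g.
pose D s := (f (g * s, h) - f (s * g, h) + (f (g, h * s) - f (g, s * h)))%g.
have D0 : \sum_s D s *~ w s = 0.
  under eq_bigr do rewrite mulrzDl !mulrzBl.
  rewrite big_split !sumrB /= (conj (fun k => f (k, h))).
  by rewrite (conj (fun k => f (g, k))) !subrr addr0.
rewrite -[LHS]addr0 -[X in _ + X]D0 -big_split; apply: eq_bigr => s _ /=.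
rewrite -mulrzBl raddfMz -!mulrzBl -!mulrzDl; congr (_ *~ _).
rewrite raddfB /= !cocycle2E /D !opprB !opprD !opprK !addrA.
rewrite [LHS](ACl ((1*6)*5*8*7*4*2*3))%AC /= subrr add0r.
by rewrite [RHS](ACl ((3*10)*(7*4)*1*2*5*6*8*9))%AC /= !subrr !add0r.
Qed.

End ClassFunction.

Section PermDecomposition.

Variable T : finType.
Implicit Types (B : {set T}) (V : zmodType) (g : {perm T}).

Lemma perm_on_split B b V (F : {perm T} -> V) : b \notin B ->
  \sum_(g | perm_on (b |: B) g) F g =
  \sum_(i in b |: B) \sum_(g | perm_on B g) F (tperm b i * g)%g.
Proof.
move=> bB; rewrite (partition_big (fun g => g^-1 b)%g (mem (b |: B))) /=.
  apply: eq_bigr => i iB; rewrite (reindex_inj (mulgI (tperm b i))) /=.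
  have tA : perm_on (b |: B) (tperm b i).
    by apply: perm_on_tperm; rewrite ?setU11.
  apply: eq_bigl => g; apply/andP/idP => [[gA /eqP gi]|gB].
    have gb : g b = b.
      have : (tperm b i * g)%g i = b by rewrite -{2}gi permKV.
      by rewrite permM tpermR.
    have := perm_onM tA gA; rewrite mulgA tperm2 mul1g => /subsetP gA'.
    apply/subsetP => y gy; have := gA' y gy; rewrite !inE => /predU1P[yb|//].
    by move: gy; rewrite inE yb gb eqxx.
  have gb : g b = b by rewrite (out_perm gB).
  split; first by apply: perm_onM tA (subset_trans gB (subsetUr _ _)).
  by rewrite (can2_eq (permKV _) (permK _)) permM tpermR gb.
by move=> g gA; rewrite -(perm_closed _ gA) permKV setU11.
Qed.

Lemma porbits_fix_tperm g b i : g b = b -> i != b ->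
  #|porbits g| = #|porbits (tperm b i * g)|.+1.
Proof.
move=> gb ib; have := porbits_mul_tperm g b i; rewrite eq_sym ib /=.
suff -> : b \notin porbit g i by rewrite -muln2 mul1n addn2 addn1 => -[->].
rewrite porbit_sym; apply/porbitP => -[k ik]; case/eqP: ib.
by rewrite ik permX; elim: k {ik} => //= k ->.
Qed.

Lemma perm_on0 g : perm_on set0 g = (g == 1%g).
Proof.
apply/idP/eqP => [gA|->]; last exact: perm_on1.
by apply/permP => y; rewrite perm1 (out_perm gA) // inE.
Qed.

Lemma porbits1 : #|porbits (1%g : {perm T})| = #|T|.
Proof.
rewrite card_in_imset // => y z _ _ /eqP; rewrite eq_porbit_mem.
by move=> /porbitP[k ->]; rewrite expg1n perm1.
Qed.

(** Jucys: the sum of [N ^ cycles g] times [g] over the symmetric group factors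
    as the product of [N + J_b] over the points [b], where the Jucys-Murphy
    element [J_b] is the sum of the transpositions of [b] with the points of
    smaller key. On a common eigenvector of the [J_b], with eigenvalues [c b],
    it acts by the product of [N + c b]. *)
Lemma jucys_murphy (V : zmodType) (a : gmodule {perm T} V) (key : T -> nat)
    (N : int) (c : T -> int) (e : V) :
    injective key ->
    (forall b, \sum_(i | (key i < key b)%N) a (tperm b i) e = e *~ c b) ->
    N != 0 -> (forall (x : V) k, x *~ k = 0 -> k != 0 -> x = 0) ->
  \sum_g a g e *~ N ^+ #|porbits g| = e *~ \prod_b (N + c b).
Proof.
move=> keyI ec N0 Vtf; pose D j := [set b | (key b < j)%N].
pose y j := \sum_(g | perm_on (D j) g) a g e *~ N ^+ #|porbits g|.
have yE j : y j *~ N ^+ #|D j| =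
  e *~ ((\prod_(b in D j) (N + c b)) * N ^+ #|T|).
  elim: j => [|j IHj].
    have D0 : D 0%N = set0 by apply/setP => b; rewrite !inE.
    rewrite /y D0 cards0 big_set0 mul1r expr0 mulr1z.
    under eq_bigl do rewrite perm_on0.
    by rewrite big_pred1_eq porbits1 Defs.gact1.
  have [b /eqP bj|nj] := pickP [pred b | key b == j]; last first.
    have Dj : D j.+1 = D j; last by rewrite /y Dj.
    by apply/setP => b; rewrite !inE ltnS leq_eqVlt; have := nj b => /= ->.
  have bD : b \notin D j by rewrite inE bj ltnn.
  have DS : D j.+1 = b |: D j.
    apply/setP => i; rewrite !inE ltnS leq_eqVlt; congr (_ || _).
    by rewrite -bj (inj_eq keyI).
  have yS : y j.+1 *~ N = y j *~ N + \sum_(i in D j) a (tperm b i) (y j).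
    rewrite {1}/y DS perm_on_split // big_setU1 //= mulrzDl; congr (_ + _).
      by congr (_ *~ _); apply: eq_bigr => g _; rewrite tperm1 mul1g.
    rewrite mulrz_suml; apply: eq_bigr => i iD.
    rewrite mulrz_suml raddf_sum; apply: eq_bigr => g gD.
    rewrite Defs.gactM raddfMz -mulrzA -exprSr (@porbits_fix_tperm g b i) //.
      by rewrite (out_perm gD).
    by apply: contraNneq bD => <-.
  rewrite DS big_setU1 // cardsU1 bD add1n exprS mulrzA yS.
  rewrite mulrzDl (_ : y j *~ N *~ _ = y j *~ N ^+ #|D j| *~ N); last first.
    by rewrite -!mulrzA mulrC.
  rewrite IHj.
  have aE i : a (tperm b i) (y j) *~ N ^+ #|D j| =
    a (tperm b i) e *~ ((\prod_(b in D j) (N + c b)) * N ^+ #|T|).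
    by rewrite -(raddfMz (a (tperm b i))) IHj (raddfMz (a (tperm b i))).
  rewrite mulrz_suml (eq_bigr _ (fun i _ => aE i)) -mulrz_suml.
  have -> : \sum_(i in D j) a (tperm b i) e = e *~ c b.
    by rewrite -ec; apply: eq_bigl => i; rewrite inE bj.
  rewrite -!mulrzA -mulrzDr; congr (_ *~ _) => /=; ring.
pose J := (\max_b key b).+1.
have DJ : D J = setT.
  by apply/setP => b; rewrite !inE ltnS; apply: leq_bigmax.
have <- : y J = \sum_g a g e *~ N ^+ #|porbits g|.
  by rewrite /y DJ; apply: eq_bigl => g; apply/subsetP.
have PJ : \prod_(b in D J) (N + c b) = \prod_b (N + c b).
  by apply: eq_bigl => b; rewrite DJ inE.
have := yE J; rewrite PJ DJ cardsT mulrzA => /eqP; rewrite -subr_eq0 -mulrzBl.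
by move/eqP/Vtf/(_ (expf_neq0 _ N0))/eqP; rewrite subr_eq0 => /eqP.
Qed.

(** The same factorisation on the trivial module. *)
Lemma sum_porbits (N : int) : N != 0 ->
  \sum_(g : {perm T}) N ^+ #|porbits g| = \prod_(i < #|T|) (N + i%:Z).
Proof.
move=> N0.
pose a := @GModule {perm T} int (fun _ x => x) (fun _ => erefl)
  (fun _ _ _ => erefl) (fun _ _ _ => erefl).
transitivity (\sum_g a g 1 *~ N ^+ #|porbits g|).
  by apply: eq_bigr => g _; rewrite intz.
rewrite (@jucys_murphy _ _ (fun b => enum_rank b) _ (fun b => enum_rank b)) //.
- by rewrite intz (reindex (@enum_rank T)) //; apply/onW_bij/enum_rank_bij.
- by move=> b i /val_inj/enum_rank_inj.
- move=> b; rewrite intz (reindex (@enum_val T T)) /=; last first.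
    by apply/onW_bij/enum_val_bij.
  under eq_bigl do rewrite enum_valK.
  rewrite -(big_ord_widen _ (fun=> 1)) ?sumr_const ?card_ord -?natz //.
  exact: ltnW.
- by move=> x k /eqP; rewrite -mulrzr mulf_eq0 intr_eq0 => /orP[/eqP|->].
Qed.

End PermDecomposition.

(** * Central characters of Specht modules *)

Lemma card_porbitsJ (T : finType) (s g : {perm T}) :
  #|porbits (s ^ g)%g| = #|porbits s|.
Proof.
have porbitJ x : porbit (s ^ g)%g (g x) = g @: porbit s x.
  apply/setP => y; rewrite -[y](permKV g) (mem_imset _ _ (@perm_inj _ g)).
  apply/porbitP/porbitP => -[k kE]; exists k.
    by apply: (@perm_inj _ g); rewrite kE -conjXg permJ.
  by rewrite -conjXg permJ kE.
rewrite -[RHS](card_imset _ (imset_inj (@perm_inj _ g))).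
congr #|pred_of_set _|.
apply/setP => A; apply/imsetP/imsetP => [[x _ ->]|[B BP ->]].
  exists (porbit s ((g^-1)%g x)); first by apply: imset_f.
  by rewrite -porbitJ permKV.
by have /imsetP[x _ ->] := BP; exists (g x) => //; rewrite porbitJ.
Qed.

Section Contents.

Variable la : seq nat.
Local Notation n := (sumn la).
Implicit Types (t : tableau la) (c : cell la) (g s : 'S_n).

Definition perm_gmodule : gmodule 'S_n (perm_module la) :=
  GModule (@perm_act1 la) (@perm_actM la) (@perm_actB la).

Lemma perm_module_torsion_free (v : perm_module la) (k : int) :
  v *~ k = 0 -> k != 0 -> v = 0.
Proof.
move=> vk k0; apply/ffunP => T; have := congr1 (coef T) vk.
rewrite raddfMz raddf0 -mulrzr => /eqP.
rewrite mulf_eq0 intr_eq0 (negPf k0) orbF.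
by rewrite ffunE => /eqP.
Qed.

Lemma perm_on_col_stab t j g : perm_on (tableau_col t j) g -> g \in col_stab t.
Proof.
move=> gA; rewrite inE; apply/forallP => j'; have [<-|jj'] := eqVneq j (val j').
  by rewrite im_perm_on.
rewrite -[X in _ == X]imset_id; apply/eqP/eq_in_imset => b.
have [c <-] := fill_surj t b; rewrite tableau_colE => /eqP cj.
by rewrite (out_perm gA) // tableau_colE cj eq_sym.
Qed.

Lemma col_stabMl t g s : g \in col_stab t ->
  ((g * s)%g \in col_stab t) = (s \in col_stab t).
Proof.
rewrite !inE => /forallP gS; apply: eq_forallb => j.
by rewrite (eq_imset _ (permM g s)) imset_comp (eqP (gS j)).
Qed.

Lemma col_stabV t g : g \in col_stab t -> (g^-1)%g \in col_stab t.
Proof.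
move=> gS; rewrite -(col_stabMl _ gS) mulgV inE; apply/forallP => j.
by rewrite -[X in _ == X]imset_id; apply/eqP/eq_imset => b; rewrite perm1.
Qed.

Lemma leq_nth_sumn (r : seq nat) i : (nth 0%N r i <= sumn r)%N.
Proof.
elim: r i => [|k r IHr] [|i] //=; first exact: leq_addr.
by apply: leq_trans (IHr i) (leq_addl _ _).
Qed.

Lemma col_stab_im t g j : g \in col_stab t ->
  g @: tableau_col t j = tableau_col t j.
Proof.
rewrite inE => /forallP gS; have [jn|nj] := ltnP j n.
  exact/eqP/(gS (Ordinal jn)).
suff -> : tableau_col t j = set0 by rewrite imset0.
apply/setP => b; have [c <-] := fill_surj t b; rewrite tableau_colE inE.
apply/eqP => cj; suff : (cell_col c < n)%N by rewrite cj ltnNge nj.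
exact: leq_trans (ltn_ord (tagged c)) (leq_nth_sumn _ _).
Qed.

Lemma perm_act_col_stab t g : g \in col_stab t ->
  perm_act g (polytabloid t) = polytabloid t *~ (-1) ^+ g.
Proof.
move=> gS; rewrite perm_act_polytabloid; set h := (g^-1)%g.
have hS : h \in col_stab t := col_stabV gS.
have -> : polytabloid (move_tableau h t) = \sum_(s in col_stab t)
    tabloid_basis (tabloid_of (move_tableau (h * s)%g t)) *~ (-1) ^+ s.
  apply: eq_big => [s|s _]; last by rewrite move_tableauM.
  rewrite !inE; apply: eq_forallb => j; rewrite tableau_col_move.
  by move: hS; rewrite inE => /forallP/(_ j)/eqP ->.
rewrite /polytabloid mulrz_suml [RHS](reindex_inj (mulgI h)).
apply: eq_big => [s|s _]; first by rewrite col_stabMl.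
by rewrite -mulrzA odd_permM odd_permV signr_addb mulrAC -expr2 sqrr_sign mul1r.
Qed.

Lemma tabloid_of_row_perm t r g : perm_on (tableau_row t r) g ->
  tabloid_of (move_tableau g t) = tabloid_of t.
Proof.
move=> gA; apply: val_inj; rewrite /= rows_of_move; apply/ffunP => i.
rewrite !ffunE; have [<-|ri] := eqVneq r (val i); first by rewrite im_perm_on.
rewrite -[RHS]imset_id; apply: eq_in_imset => b.
have [c <-] := fill_surj t b; rewrite tableau_rowE => /eqP ci.
by rewrite (out_perm gA) // tableau_rowE ci eq_sym.
Qed.

Lemma perm_act_basis_row t r p q :
    p \in tableau_row t r -> q \in tableau_row t r ->
  perm_act (tperm p q) (tabloid_basis (tabloid_of t)) =
  tabloid_basis (tabloid_of t).
Proof.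
move=> pr qr; rewrite perm_act_basis (@tabloid_of_row_perm _ r) //.
by rewrite tpermV; apply: perm_on_tperm.
Qed.

Lemma geq_trans : transitive geq.
Proof. by move=> y x z yx zy; apply: leq_trans zy yx. Qed.

Lemma antisymmetrizer_eq0 (A : {set 'I_n}) p q (v : perm_module la) :
    p \in A -> q \in A -> p != q -> perm_act (tperm p q) v = v ->
  \sum_(g | perm_on A g) perm_act g v *~ (-1) ^+ g = 0.
Proof.
move=> pA qA pq pqv; set X := \sum_(g | _) _.
suff XN : X = - X.
  apply: (@perm_module_torsion_free _ 2) => //.
  by rewrite -[2]/(1 + 1) mulrzDr mulr1z {1}XN addNr.
rewrite {1}/X (reindex_inj (mulIg (tperm p q))) -sumrN.
have tA := perm_on_tperm pA qA.
apply: eq_big => [g|g _].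
  apply/idP/idP => gA; last exact: perm_onM.
  by rewrite -[g](mulgK (tperm p q)) tpermV; apply: perm_onM.
by rewrite perm_actM pqv odd_permM odd_tperm pq addbT signrN mulrNz.
Qed.

(** The Garnir relation for a column and one node to its right: the
    antisymmetrizer over their entries kills the polytabloid, because in each
    term of the polytabloid the row of that node meets the column. *)
Lemma garnir t c j : (j < cell_col c)%N ->
  \sum_(i in tableau_col t j) perm_act (tperm (fill t c) i) (polytabloid t) =
  polytabloid t.
Proof.
move=> jc; set m := fill t c; set B := tableau_col t j.
have mB : m \notin B by rewrite tableau_colE gtn_eqF.
pose F g := perm_act g (polytabloid t) *~ (-1) ^+ g.
have sumF : \sum_(g | perm_on (m |: B) g) F g = 0.
  rewrite /F /polytabloid.
  under eq_bigr => g _.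
    rewrite raddf_sum mulrz_suml.
    under eq_bigr => s _ do rewrite raddfMz -mulrzA mulrC mulrzA /=.
    over.
  rewrite exchange_big big1 //= => s sC; rewrite -mulrz_suml.
  rewrite [X in X *~ _](_ : _ = 0) ?mul0rz //.
  have sB i : s @: tableau_col t i = tableau_col t i by apply: col_stab_im.
  have : m \in s @: tableau_col t (cell_col c) by rewrite sB tableau_colE.
  case/imsetP=> b; have [c1 <-] := fill_surj t b.
  rewrite tableau_colE => /eqP c1c mE.
  have jr : (j < nth 0%N la (tag c1))%N.
    by apply: ltn_trans jc _; rewrite -c1c; apply: ltn_ord.
  pose c2 : cell la :=
    Tagged (fun i : 'I_(size la) => 'I_(nth 0%N la i)) (Ordinal jr).
  have qB : s (fill t c2) \in B.
    by rewrite -[B]sB mem_imset ?tableau_colE //; apply: perm_inj.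
  apply: (@antisymmetrizer_eq0 _ m (s (fill t c2))).
  - exact: setU11.
  - by rewrite !inE qB orbT.
  - by apply: contraNneq mB => ->.
  by rewrite mE -!fill_move; apply: (@perm_act_basis_row _ (cell_row c1));
     rewrite tableau_rowE.
have FE i : i \in m |: B ->
    \sum_(g | perm_on B g) F (tperm m i * g)%g =
    perm_act (tperm m i) (polytabloid t) *~ (-1) ^+ (m != i)
      *+ #|[set g | perm_on B g]|.
  move=> iB; rewrite -sumr_const.
  apply: eq_big => [g|g gB]; first by rewrite inE.
  rewrite /F perm_actM perm_act_col_stab ?(perm_on_col_stab gB) //.
  rewrite raddfMz -mulrzA odd_mul_tperm addbC signr_addb mulrA -expr2.
  by rewrite sqrr_sign mul1r.
move: sumF; rewrite perm_on_split // (eq_bigr _ FE) big_setU1 //= eqxx.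
rewrite tperm1 perm_act1 expr0 mulr1z.
under eq_bigr => i iB.
  rewrite (_ : m != i); last by apply: contraNneq mB => ->.
  rewrite expr1 mulrN1z mulNrn; over.
rewrite sumrN sumrMnl -mulrnBl pmulrn => /perm_module_torsion_free e0.
apply/esym/eqP; rewrite -subr_eq0; apply/eqP/e0.
by rewrite eqz_nat -lt0n; apply/card_gt0P; exists 1%g; rewrite inE perm_on1.
Qed.

Definition cell_of t b : cell la := projT1 (cid (fill_surj t b)).

Lemma cell_ofK t b : fill t (cell_of t b) = b.
Proof. by rewrite /cell_of; case: cid. Qed.

(** Columns from left to right, each of them from top to bottom. *)
Definition column_key t b : nat :=
  (cell_col (cell_of t b) * size la + cell_row (cell_of t b))%N.

Lemma column_key_lt t b i : (column_key t i < column_key t b)%N =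
  (cell_col (cell_of t i) < cell_col (cell_of t b))%N
  || (cell_col (cell_of t i) == cell_col (cell_of t b))
     && (cell_row (cell_of t i) < cell_row (cell_of t b))%N.
Proof.
have row_lt c : (cell_row c < size la)%N by apply: ltn_ord.
have := row_lt (cell_of t i); have := row_lt (cell_of t b).
rewrite /column_key; move: (cell_row _) (cell_row _) (cell_col _) (cell_col _).
by move=> rb ri cb ci; nia.
Qed.

Lemma column_key_inj t : injective (column_key t).
Proof.
move=> b i e; have := column_key_lt t b i; have := column_key_lt t i b.
rewrite e ltnn => lt1 lt2.
rewrite -[b](cell_ofK t) -[i](cell_ofK t); congr fill.
by apply: cell_eqP; lia.
Qed.

Definition content c : int := (cell_col c)%:Z - (cell_row c)%:Z.

(** The nodes of each column to the left contribute the polytabloid itself, by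
    the Garnir relation, and the nodes above its opposite. *)
Lemma jucys_murphy_polytabloid t b : sorted geq la ->
  \sum_(i | (column_key t i < column_key t b)%N)
     perm_act (tperm b i) (polytabloid t) =
  polytabloid t *~ content (cell_of t b).
Proof.
move=> la_dec; set c := cell_of t b; set e := polytabloid t.
have bE : b = fill t c by rewrite cell_ofK.
have colE i j : (cell_col (cell_of t i) == j) = (i \in tableau_col t j).
  by rewrite -{2}[i](cell_ofK t) tableau_colE.
have left C : (C <= cell_col c)%N ->
    \sum_(i | (cell_col (cell_of t i) < C)%N) perm_act (tperm b i) e = e *+ C.
  elim: C => [|C IHC] Cc; first by rewrite big_pred0.
  rewrite (bigID (fun i => i \in tableau_col t C)) /= mulrS; congr (_ + _).
    rewrite -[RHS](garnir t Cc) -bE; apply: eq_bigl => i.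
    by rewrite -colE; lia.
  by rewrite -IHC 1?ltnW //; apply: eq_bigl => i; rewrite -colE; lia.
have above : \sum_(i | (i \in tableau_col t (cell_col c))
      && (cell_row (cell_of t i) < cell_row c)%N) perm_act (tperm b i) e =
    - e *+ cell_row c.
  have lt_row (r : 'I_(cell_row c)) : (r < size la)%N.
    by apply: ltn_trans (ltn_ord r) (ltn_ord (tag c)).
  have lt_col (r : 'I_(cell_row c)) :
      (cell_col c < nth 0%N la (Ordinal (lt_row r)))%N.
    apply: leq_trans (ltn_ord (tagged c)) _.
    apply: (sorted_ltn_nth geq_trans 0%N la_dec); rewrite ?inE //.
    exact: (ltn_ord r).
  pose F (r : 'I_(cell_row c)) : 'I_n := fill t (Tagged
    (fun i : 'I_(size la) => 'I_(nth 0%N la i)) (Ordinal (lt_col r))).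
  have FI : injective F.
    move=> r r' /fill_inj/(congr1 (@cell_row la)) rr'; apply: val_inj.
    exact: rr'.
  have cF r : cell_of t (F r) = Tagged
    (fun i : 'I_(size la) => 'I_(nth 0%N la i)) (Ordinal (lt_col r)).
    by apply: (@fill_inj _ t); rewrite cell_ofK.
  rewrite -[X in _ *+ X]card_ord -(card_imset _ FI) -sumr_const.
  apply: eq_big => [i|i /andP[ic ri]].
    apply/andP/imsetP => [[ic ri]|[r _ ->]]; last first.
      by rewrite -colE !cF; split; [exact: eqxx | exact: (ltn_ord r)].
    exists (Ordinal ri) => //; rewrite /F -{1}[i](cell_ofK t); congr fill.
    by apply: cell_eqP => //=; apply/eqP; rewrite colE.
  have tA : perm_on (tableau_col t (cell_col c)) (tperm b i).
    by apply: perm_on_tperm; rewrite // bE tableau_colE.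
  rewrite perm_act_col_stab ?(perm_on_col_stab tA) // odd_tperm.
  suff -> : b != i by rewrite expr1 mulrN1z.
  by apply: contraTneq ri => <-; rewrite ltnn.
rewrite (bigID (fun i => i \in tableau_col t (cell_col c))) /= addrC.
rewrite /content mulrzBr -!pmulrn -mulNrn; congr (_ + _).
  rewrite -(left _ (leqnn _)); apply: eq_bigl => i.
  by rewrite column_key_lt -colE -/c; lia.
rewrite -above; apply: eq_bigl => i.
by rewrite column_key_lt -colE -/c; lia.
Qed.

Lemma central_specht (N : int) (v : specht la) : sorted geq la -> N != 0 ->
  \sum_g perm_act g (val v) *~ N ^+ #|porbits g| =
  val v *~ \prod_c (N + content c).
Proof.
move=> la_dec N0.
apply: (@specht_ind la (fun u => \sum_g perm_act g u *~ N ^+ #|porbits g| =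
  u *~ \prod_c (N + content c))).
- by rewrite mul0rz big1 // => g _; rewrite raddf0 mul0rz.
- move=> u w uE wE; rewrite mulrzBl -uE -wE -sumrB; apply: eq_bigr => g _.
  by rewrite raddfB mulrzBl.
move=> t; have := @jucys_murphy _ _ perm_gmodule (column_key t) N
  (fun b => content (cell_of t b)) (polytabloid t) (@column_key_inj t).
move=> -> //; last exact: perm_module_torsion_free.
  congr (_ *~ _); rewrite (reindex (fill t)) /=.
    apply: eq_bigr => c _; congr (_ + content _).
    by apply: (@fill_inj _ t); rewrite cell_ofK.
  by apply/onW_bij; exists (cell_of t) => c; [apply: (@fill_inj _ t)|];
     rewrite cell_ofK.
by move=> b; apply: jucys_murphy_polytabloid.
Qed.

(** The trivial module and the Specht module are separated by their central
    characters modulo [p]. With N the number of rows, N + (content) ranges from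
    1 to the hook length of the corner, which is less than [p] for a partition
    of [p] that is not a hook. *)
Lemma H2_non_hook p : prime p -> is_partition la -> n = p ->
  (1 < nth 0%N la 1)%N -> ~ dvd_order p (H2_specht la).
Proof.
move=> p_pr /andP[la_dec la_pos] np la2.
have [la_gt0 bound] : (0 < size la)%N /\ (nth 0%N la 0 + size la <= n)%N.
  case: (la) la_pos la2 => [|d [|b r]] //= /and3P[_ _ r1] b2; split=> //.
  have : (size r <= sumn r)%N; last by lia.
  by elim: r r1 => //= k r IHr /andP[k1 /IHr]; lia.
pose N := (size la)%:Z; have N0 : N != 0 by rewrite eqz_nat -lt0n.
pose w (g : 'S_n) : int := N ^+ #|porbits g|.
have wC g h : w (g * h)%g = w (h * g)%g.
  rewrite /w -(card_porbitsJ _ g) conjgE.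
  by rewrite !mulgA mulVg mul1g.
pose C := \prod_(c : cell la) (N + content c).
pose S := \sum_g w g.
have aug : (p %| absz S)%N.
  rewrite /S /w sum_porbits // card_ord np.
  have i_lt : (p - size la < p)%N by lia.
  (* The factor of index p - N is p itself. *)
  rewrite (bigD1 (Ordinal i_lt)) //= abszM dvdn_mulr //.
  by rewrite -PoszD subnKC //; lia.
have pC : ~~ (p %| `|C|)%N.
  rewrite /C; apply: (big_ind (fun z : int => ~~ (p %| `|z|)%N)).
  - by rewrite gtnNdvd // prime_gt1.
  - by move=> y z py pz; rewrite abszM Euclid_dvdM // negb_or py.
  move=> c _; have row_lt : (cell_row c < size la)%N by apply: ltn_ord.
  have col_lt : (cell_col c < nth 0%N la 0)%N.
    apply: leq_trans (ltn_ord (tagged c)) _.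
    by apply: (sorted_leq_nth geq_trans leqnn 0%N la_dec); rewrite ?inE.
  have -> : absz (N + content c) = (size la + cell_col c - cell_row c)%N.
    by rewrite /N /content; lia.
  by rewrite gtnNdvd //; lia.
have kill (x : H2_specht la) : x *~ (C - S) = 0.
  apply: H2_central_kill => // v; apply: val_inj.
  rewrite raddf_sum raddfMz -(central_specht v la_dec N0).
  by apply: eq_bigr => g _; rewrite raddfMz.
have killn (x : H2_specht la) : x *+ absz (C - S) = 0.
  have := kill x; case: (C - _) => k //=.
  by rewrite NegzE mulrNz => /eqP; rewrite oppr_eq0 => /eqP.
apply: not_dvd_order p_pr _ killn.
have : (p %| C - S)%Z = (p %| C)%Z.
  by rewrite rpredBr.
by rewrite !dvdzE => ->.
Qed.

End Contents.

(** * The partitions near a three-part hook *)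

Lemma partition_cases la : is_partition la -> (0 < sumn la)%N ->
  (1 < nth 0%N la 1)%N \/
  exists m s, [/\ la = m :: s, (0 < m)%N & all (pred1 1%N) s].
Proof.
case: la => [|m [|b r]] //= /andP[la_dec /andP[m0 la_pos]] _.
  by right; exists m, [::].
have [b2|b1] := ltnP 1 b; [by left | right]; exists m, (b :: r); split=> //.
move: la_dec => /= /andP[_ br]; move: la_pos => /= /andP[b0 r_pos].
have /allP r_le := order_path_min geq_trans br; apply/andP; split; first by lia.
by apply/allP => x xr; have := r_le x xr; have := allP r_pos x xr => /=; lia.
Qed.

Lemma hook2_node_removal m mu i :
    is_partition mu -> [:: m; 1; 1]%N = incr_nth mu i ->
  mu = [:: m; 1%N] \/ exists2 k, m = k.+1 & mu = [:: k; 1; 1]%N.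
Proof.
move=> /andP[_ mu_pos] e; have := congr1 size e; rewrite size_incr_nth /=.
case: mu mu_pos e => [|a [|b [|c [|d r]]]] /=.
- by move=> _ e; case: i e => [|[|[|i]]].
- by move=> _; case: i => [|[|[|i]]].
- move=> _; case: i => [|[|[|i]]] //= [-> ->] _; by left.
- case: i => [|[|[|i]]] //=.
  + by move=> /and4P[a0 _ _ _] [-> -> ->] _; right; exists a.
  + by move=> /and4P[_ b0 _ _] [_ b1 _]; lia.
  + by move=> /and4P[_ _ c0 _] [_ _ c1]; lia.
- by move=> _ _; case: ifP => //; lia.
Qed.

Lemma prime_dvd_8M p k : prime p -> (2 < p)%N -> (p %| 8 * k)%N = (p %| k)%N.
Proof.
move=> p_pr p_gt2; rewrite Gauss_dvdr // prime_coprime //.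
by rewrite -[8%N]/(2 ^ 3)%N Euclid_dvdX // gtnNdvd.
Qed.

Lemma not_dvd_signc p k : prime p -> (2 < p)%N -> (1 < k < p)%N ->
  ~~ (p %| signc k)%N.
Proof.
move=> p_pr p_gt2 /andP[k1 kp].
by rewrite /signc -mul2n !Euclid_dvdM // !negb_or !gtnNdvd //; lia.
Qed.

Local Close Scope quotient_scope.
Local Close Scope ring_scope.

Theorem lemma6p1 (p n : nat) (p_pr : prime p) (p_gt2 : 2 < p) (n_ge3 : 3 <= n) :
  let la := [:: n - 2; 1; 1] in
  [/\ C2 p la <-> p %| n,
      C2 p la ->
        has_p_rank p (H2_specht la) 1 /\ ~ (exists mu, predecessor p mu la)
    & n = p -> forall mu, C2 p mu /\ sumn mu = n <-> mu = la].
Proof.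
move=> la.
have m_gt0 : 0 < n - 2 by lia.
have sn : sumn la = n by rewrite /la /=; lia.
have two : ~~ (p %| 2) by rewrite gtnNdvd.
have kill2 m : 0 < m -> dvd_order p (H2_specht [:: m; 1; 1]) -> p %| m.+2.
  move=> m0; apply: contraPT => pm.
  apply: (@not_dvd_order p _ (8 * sumn [:: m; 1; 1])) => //.
    by rewrite prime_dvd_8M //= addn1 addn2.
  exact: H2_hook2.
have rank_la : p %| n ->
    dvd_order p (H2_specht la) /\ has_p_rank p (H2_specht la) 1.
  by move=> pn; apply: hook2_rank; rewrite // -/la sn.
have C2_la : C2 p la <-> p %| n.
  split=> [[_ /(kill2 _ m_gt0)]|pn]; first by rewrite -addn2 subnK //; lia.
  by split; [rewrite /is_partition /=; lia | case: (rank_la pn)].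
split=> // [/C2_la pn|np mu].
  split; first by case: (rank_la pn).
  move=> [mu [[mu_part muH] _ [_ _ [i /(hook2_node_removal mu_part)]]]].
  case=> [mu_eq|[k kE mu_eq]]; rewrite mu_eq in muH mu_part.
    by apply: not_dvd_order muH; last exact: H2_hook1.
  have k0 : 0 < k by move: mu_part; rewrite /is_partition /=; lia.
  have := kill2 k k0 muH; rewrite (_ : k.+2 = n.-1); last by lia.
  move=> pn1; have : p %| n - n.-1 by apply: dvdn_sub.
  by rewrite (_ : n - n.-1 = 1); [rewrite gtnNdvd //; lia | lia].
split=> [[[mu_part muH] mun]|->]; last by split; rewrite ?C2_la ?np ?sn.
have mu_gt0 : 0 < sumn mu by rewrite mun; lia.
have [mu2|[m [s [mu_eq m0 s1]]]] := partition_cases mu_part mu_gt0.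
  by case: (@H2_non_hook mu p p_pr mu_part _ mu2 muH); rewrite mun.
rewrite {}mu_eq in muH mun *.
case: s s1 muH mun => [|a [|b [|c s]]] /=.
- by move=> _ muH _; case: (not_dvd_order p_pr two _ muH); apply: H2_row.
- move=> /andP[/eqP -> _] muH _.
  by case: (not_dvd_order p_pr two _ muH); apply: H2_hook1.
- by move=> /and3P[/eqP -> /eqP -> _] _ mn; rewrite /la; congr (_ :: _); lia.
move=> /and4P[/eqP -> /eqP -> /eqP -> s1] muH mun.
have s_lt : size s + 3 < p.
  have : sumn s = size s.
    by elim: s s1 {muH mun} => //= k s IHs /andP[/eqP -> /IHs ->].
  by lia.
case: (@not_dvd_order p _ (signc (size s).+2 * signc (size s).+3) p_pr _ _ muH).
  by rewrite Euclid_dvdM // negb_or !not_dvd_signc //; lia.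
by move=> x; apply: H2_hook3.
Qed.
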